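(* Let $m,n\ge1$ be integers and let $P\in\mathbb{R}$ be such that $0\le P<m^2<n^2$. There exist $0<E_1\le E_2$ such that: (i) if $0<E_{\Theta_m}<E_1$ then $\Theta_m$ is linearly stable with respect to $\Theta_n$; (ii) if $\frac{n^2}{m^2}\in I_U$ and $E_{\Theta_m}>E_2$ then $\Theta_m$ is linearly unstable with respect to $\Theta_n$; (iii) if $\frac{n^2}{m^2}\in I_S$ and $E_{\Theta_m}>E_2$ then $\Theta_m$ is linearly stable with respect to $\Theta_n$.
   Context: With $\mathbb{N}=\{0,1,2,\dots\}$, define $$I_U:=\bigcup_{k\in\mathbb{N}}\big((k+1)(2k+1),(k+1)(2k+3)\big),\qquad I_S:=\bigcup_{k\in\mathbb{N}}\big(k(2k+1),(k+1)(2k+1)\big).$$ $\Theta_m$ denotes any solution $\Theta_m:\mathbb{R}\to\mathbb{R}$ of the Duffing equation $$\ddot{\Theta}_m(t)+m^2(m^2-P)\Theta_m(t)+m^4\Theta_m(t)^3=0 ,$$ and its (constant) energy is $$E_{\Theta_m}=\frac{\dot{\Theta}_m(0)^2}{2}+\frac{m^2(m^2-P)}{2}\Theta_m(0)^2+\frac{m^4}{4}\Theta_m(0)^4 .$$ The assertions hold for every solution $\Theta_m$ whose energy lies in the indicated range. $\Theta_m$ is said to be linearly stable (unstable) with respect to the $n$-th mode $\Theta_n$ if $\xi\equiv0$ is a stable (unstable) solution of the Hill equation $$\ddot{\xi}+a(t)\xi=0,\qquad a(t)=n^2(n^2-P)+m^2n^2\Theta_m(t)^2 ;$$ stability of $\xi\equiv0$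 is equivalent to all solutions $\xi$ being bounded on $\mathbb{R}$, and unstable means not stable. *)

(* Defs.v *)
From Stdlib Require Import Reals.
From Coquelicot Require Import Coquelicot.
Open Scope R_scope.

Definition I_U (x : R) : Prop :=
  exists k : nat,
    (INR k + 1) * (2 * INR k + 1) < x < (INR k + 1) * (2 * INR k + 3).

Definition I_S (x : R) : Prop :=
  exists k : nat,
    INR k * (2 * INR k + 1) < x < (INR k + 1) * (2 * INR k + 1).

(** [Derive] is total, so [ex_derive_n x 2 t], which only says that [Derive x]
    is differentiable at [t], does not imply that [x] itself is
    differentiable. *)
Definition twice_differentiable (x : R -> R) : Prop :=
  forall t : R, ex_derive x t /\ ex_derive_n x 2 t.

Definition duffing_solution (m : nat) (P : R) (Theta : R -> R) : Prop :=
  twice_differentiable Theta /\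
  forall t : R,
    Derive_n Theta 2 t + INR m ^ 2 * (INR m ^ 2 - P) * Theta t
      + INR m ^ 4 * Theta t ^ 3 = 0.

(** The energy is constant along solutions of the Duffing equation; it is
    evaluated at time [0]. *)
Definition energy (m : nat) (P : R) (Theta : R -> R) : R :=
  Derive Theta 0 ^ 2 / 2 + INR m ^ 2 * (INR m ^ 2 - P) / 2 * Theta 0 ^ 2
    + INR m ^ 4 / 4 * Theta 0 ^ 4.

Definition hill_solution (a xi : R -> R) : Prop :=
  twice_differentiable xi /\
  forall t : R, Derive_n xi 2 t + a t * xi t = 0.

(** Lyapunov stability, in the phase plane [(xi, xi')], of the solution
    [xi = 0] of [xi'' + a(t) xi = 0].  The equation is linear, so for periodic
    [a] this amounts to boundedness on [R] of all solutions. *)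
Definition zero_stable (a : R -> R) : Prop :=
  forall t0 eps : R, 0 < eps ->
  exists delta : R, 0 < delta /\
    forall xi : R -> R, hill_solution a xi ->
      Rabs (xi t0) < delta -> Rabs (Derive xi t0) < delta ->
      forall t : R, t0 <= t ->
        Rabs (xi t) < eps /\ Rabs (Derive xi t) < eps.

Definition hill_coef (m n : nat) (P : R) (Theta : R -> R) (t : R) : R :=
  INR n ^ 2 * (INR n ^ 2 - P) + INR m ^ 2 * INR n ^ 2 * Theta t ^ 2.

Definition linearly_stable (m n : nat) (P : R) (Theta : R -> R) : Prop :=
  zero_stable (hill_coef m n P Theta).

Definition linearly_unstable (m n : nat) (P : R) (Theta : R -> R) : Prop :=
  ~ linearly_stable m n P Theta.

(* Main.v *)
(* Energy conservation gives [Theta = A sin s(t)] with a phase [s' = G(s) > 0], so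
   in the variable [s] the Hill equation has explicit even [PI]-periodic
   coefficients depending on [L = A^2].  By these symmetries the monodromy is
   determined by the fundamental matrix [[a, b], [c, d]] of the quarter period
   [0, PI/2]: its trace is [2 (a d + b c)], and since [a d - b c = 1] the equation
   is stable if [a b c d < 0] and unstable if [a b c d > 0].

   Large [L]: after rescaling, the coefficients converge to those of
   [x'' + gam v^2 x = 0] along [v'' + v^3 = 0], with [gam = n^2 / m^2].  Writing
   [gam = nu (nu + 1) / 2], a Darboux-type transformation sends [nu] to [nu + 2]
   and preserves the sign of [a b c d]; this reduces [I_U] to [-1 < nu < 0], where
   [gam < 0], and [I_S] to [0 < nu < 1], which is settled by Sturm comparison with
   the solutions [v] (gam = 1) and [v'] (gam = 3).

   Small [L]: the limit is a rotation with frequency ratio [kap > 1], and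
   [a b c d] is close to [- sin (kap PI)^2 / 4].  If this vanishes, [kap >= 2] is
   an integer, the resonance acts only at higher order, and the first-order
   frequency shift decides the sign. *)
Require Import Defs.
From Stdlib Require Import Reals Lra Lia Factorial Ranalysis5 Classical.
From Coquelicot Require Import Coquelicot.
Open Scope R_scope.


(** The sign criterion comes from [(a d + b c)^2 - 1 = 4 a b c d], which follows from
    [a d - b c = 1]. A strict sign of [a b c d] is an open condition on the coefficients over
    [[0, PI/2]], so settling it for a limit system settles it for all amplitudes near that limit.

    Taking the phase as independent variable pays twice: the period is [PI] at every energy, so all
    comparisons take place on one fixed interval, and the coefficients are elementary instead of
    elliptic. The velocity may also be divided by a free constant [lam]; it is [sqrt c] for small
    [L] and [sqrt (be L)] for large [L], which makes the coefficients converge.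

    Openness fails only at a resonance of the small amplitude limit, where two of the four entries
    tend to 0. Both then have a first-order term proportional to [3 be / al - 2 mu / c]. Here
    [be / al = m^2 / (m^2 - P)] and [mu / c = m^2 / (n^2 - P)], so [m < n] makes it positive,
    whichever of the two pairs of entries degenerates. *)

Lemma Derive_eta (f : R -> R) (t l : R) :
  is_derive f t l -> Derive (fun u => f u) t = l.
Proof. exact (is_derive_unique f t l). Qed.

(** For abstract functions [auto_derive] leaves terms [Derive (fun u => f u) t]; the [is_derive]
    hypotheses in the context supply their values. *)
Ltac derive_solve :=
  auto_derive;
  [ repeat split; try (eexists; eassumption)
  | repeat (erewrite Derive_eta; [ | eassumption ]) ].

(** * Planar linear systems with off-diagonal coefficients *)

Definition lin_sys (p r x y : R -> R) : Prop :=
  forall t, is_derive x t (p t * y t) /\ is_derive y t (r t * x t).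

Lemma is_derive_0_const (f : R -> R) :
  (forall t, is_derive f t 0) -> forall a b, f a = f b.
Proof.
  intros H a b.
  destruct (MVT_gen f a b (fun _ => 0)) as [c [_ Hc]].
  - intros x _. apply H.
  - intros x _. apply continuity_pt_filterlim.
    apply (ex_derive_continuous f). exists 0. apply H.
  - lra.
Qed.

Lemma lin_sys_wronskian p r x1 y1 x2 y2 :
  lin_sys p r x1 y1 -> lin_sys p r x2 y2 ->
  forall s t, x1 s * y2 s - y1 s * x2 s = x1 t * y2 t - y1 t * x2 t.
Proof.
  intros H1 H2 s t.
  apply (is_derive_0_const (fun t => x1 t * y2 t - y1 t * x2 t)).
  intros u. destruct (H1 u), (H2 u). derive_solve. ring.
Qed.

Lemma lin_sys_comb p r x1 y1 x2 y2 u w :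
  lin_sys p r x1 y1 -> lin_sys p r x2 y2 ->
  lin_sys p r (fun t => u * x1 t + w * x2 t) (fun t => u * y1 t + w * y2 t).
Proof.
  intros H1 H2 t. destruct (H1 t), (H2 t).
  split; derive_solve; ring.
Qed.

(** Cramer's rule: the coefficients are Wronskians of [(x, y)] with the basis, and these are
    constant, so they may be computed at [t0] and used at [t]. *)
Lemma lin_sys_repr p r x1 y1 x2 y2 x y t0 :
  lin_sys p r x1 y1 -> lin_sys p r x2 y2 -> lin_sys p r x y ->
  x1 t0 * y2 t0 - y1 t0 * x2 t0 = 1 ->
  forall t,
    x t = (x t0 * y2 t0 - y t0 * x2 t0) * x1 t
          + (x1 t0 * y t0 - y1 t0 * x t0) * x2 t /\
    y t = (x t0 * y2 t0 - y t0 * x2 t0) * y1 t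
          + (x1 t0 * y t0 - y1 t0 * x t0) * y2 t.
Proof.
  intros H1 H2 H W t.
  rewrite (lin_sys_wronskian _ _ _ _ _ _ H H2 t0 t).
  rewrite (lin_sys_wronskian _ _ _ _ _ _ H1 H t0 t).
  rewrite (lin_sys_wronskian _ _ _ _ _ _ H1 H2 t0 t) in W.
  split.
  - replace (x t) with (x t * 1) at 1 by ring. rewrite <- W. ring.
  - replace (y t) with (y t * 1) at 1 by ring. rewrite <- W. ring.
Qed.

Definition fundamental (p r x1 y1 x2 y2 : R -> R) : Prop :=
  lin_sys p r x1 y1 /\ lin_sys p r x2 y2 /\
  x1 0 = 1 /\ y1 0 = 0 /\ x2 0 = 0 /\ y2 0 = 1.

Lemma fundamental_det p r x1 y1 x2 y2 :
  fundamental p r x1 y1 x2 y2 -> forall t, x1 t * y2 t - y1 t * x2 t = 1.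
Proof.
  intros (H1 & H2 & E1 & E2 & E3 & E4) t.
  rewrite (lin_sys_wronskian _ _ _ _ _ _ H1 H2 t 0), E1, E2, E3, E4. ring.
Qed.

Lemma fundamental_repr p r x1 y1 x2 y2 x y :
  fundamental p r x1 y1 x2 y2 -> lin_sys p r x y ->
  forall t, x t = x 0 * x1 t + y 0 * x2 t /\ y t = x 0 * y1 t + y 0 * y2 t.
Proof.
  intros HF H t. pose proof (fundamental_det _ _ _ _ _ _ HF 0) as W.
  destruct HF as (H1 & H2 & E1 & E2 & E3 & E4).
  pose proof (lin_sys_repr _ _ _ _ _ _ _ _ 0 H1 H2 H W t) as [Ex Ey].
  rewrite Ex at 1. rewrite Ey at 1. rewrite E1, E2, E3, E4. split; ring.
Qed.

(** * Floquet theory for even [PI]-periodic coefficients *)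

Section Floquet.

Variables p r x1 y1 x2 y2 : R -> R.
Hypothesis p_even : forall s, p (- s) = p s.
Hypothesis r_even : forall s, r (- s) = r s.
Hypothesis p_per : forall s, p (s + PI) = p s.
Hypothesis r_per : forall s, r (s + PI) = r s.
Hypothesis HF : fundamental p r x1 y1 x2 y2.

Let a := x1 (PI / 2).
Let b := x2 (PI / 2).
Let c := y1 (PI / 2).
Let d := y2 (PI / 2).

Lemma lin_sys_shift x y :
  lin_sys p r x y -> lin_sys p r (fun s => x (s + PI)) (fun s => y (s + PI)).
Proof.
  intros H t. destruct (H (t + PI)) as [Hx Hy].
  rewrite p_per in Hx. rewrite r_per in Hy.
  split; derive_solve; ring.
Qed.

Lemma lin_sys_reflect x y :
  lin_sys p r x y ->
  lin_sys p r (fun s => x (PI - s)) (fun s => - y (PI - s)).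
Proof.
  intros H t. destruct (H (PI - t)) as [Hx Hy].
  replace (p (PI - t)) with (p t) in Hx
    by (rewrite <- p_even, <- p_per; f_equal; ring).
  replace (r (PI - t)) with (r t) in Hy
    by (rewrite <- r_even, <- r_per; f_equal; ring).
  split; derive_solve; ring.
Qed.

(** The point [PI / 2] is fixed by the reflection [s -> PI - s]. A reflected solution has there the
    data of the original with the second component negated; expanding it in the basis and evaluating
    at 0 gives the values at [PI]. *)
Lemma monodromy_entries :
  x1 PI = a * d + b * c /\ y1 PI = 2 * a * c /\
  x2 PI = 2 * b * d /\ y2 PI = a * d + b * c.
Proof.
  pose proof (fundamental_det _ _ _ _ _ _ HF (PI / 2)) as W.
  destruct HF as (H1 & H2 & E1 & E2 & E3 & E4).
  pose proof (lin_sys_repr _ _ _ _ _ _ _ _ (PI / 2) H1 H2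
                (lin_sys_reflect _ _ H1) W 0) as [A1 A2].
  pose proof (lin_sys_repr _ _ _ _ _ _ _ _ (PI / 2) H1 H2
                (lin_sys_reflect _ _ H2) W 0) as [B1 B2].
  rewrite E1, E3 in A1. rewrite E2, E4 in A2.
  rewrite E1, E3 in B1. rewrite E2, E4 in B2.
  replace (PI - 0) with PI in * by ring.
  replace (PI - PI / 2) with (PI / 2) in * by field.
  fold a b c d in A1, A2, B1, B2. repeat split; lra.
Qed.

Lemma fundamental_shift s :
  x1 (s + PI) = (a * d + b * c) * x1 s + (2 * a * c) * x2 s /\
  y1 (s + PI) = (a * d + b * c) * y1 s + (2 * a * c) * y2 s /\
  x2 (s + PI) = (2 * b * d) * x1 s + (a * d + b * c) * x2 s /\
  y2 (s + PI) = (2 * b * d) * y1 s + (a * d + b * c) * y2 s.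
Proof.
  destruct monodromy_entries as (M1 & M2 & M3 & M4).
  pose proof HF as (H1 & H2 & _).
  destruct (fundamental_repr _ _ _ _ _ _ _ _ HF (lin_sys_shift _ _ H1) s) as [A1 A2].
  destruct (fundamental_repr _ _ _ _ _ _ _ _ HF (lin_sys_shift _ _ H2) s) as [B1 B2].
  rewrite Rplus_0_l, M1, M2 in A1, A2. rewrite Rplus_0_l, M3, M4 in B1, B2.
  repeat split; assumption.
Qed.

Lemma half_det : a * d - b * c = 1.
Proof.
  pose proof (fundamental_det _ _ _ _ _ _ HF (PI / 2)) as W.
  fold a b c d in W. lra.
Qed.

Lemma periodic_bounded (f : R -> R) :
  (forall s, continuity_pt f s) -> (forall s, f (s + PI) = f s) ->
  exists B, forall s, f s <= B.
Proof.
  intros Hc Hper.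
  assert (HN : forall k s, f (s + INR k * PI) = f s).
  { induction k as [|k IH]; intros s.
    - f_equal. simpl. ring.
    - rewrite S_INR. replace (s + (INR k + 1) * PI) with ((s + INR k * PI) + PI) by ring.
      rewrite Hper. apply IH. }
  pose proof PI_RGT_0 as HPI.
  destruct (continuity_ab_maj f 0 PI) as [M [HM _]].
  { lra. } { intros; apply Hc. }
  exists (f M). intros s.
  destruct (archimed (s / PI)) as [K1 K2].
  set (k := (up (s / PI) - 1)%Z).
  assert (Hk : 0 <= s - IZR k * PI <= PI).
  { unfold k. rewrite minus_IZR.
    assert (E : s = s / PI * PI) by (field; lra).
    set (z := s / PI) in *. rewrite E. split; nra. }
  replace (f s) with (f (s - IZR k * PI)); [apply HM, Hk|].
  clearbody k. clear Hk K1 K2. destruct k as [|q|q].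
  - f_equal. ring.
  - rewrite <- (HN (Pos.to_nat q) (s - IZR (Zpos q) * PI)). f_equal.
    rewrite INR_IPR. unfold IZR. ring.
  - rewrite <- (HN (Pos.to_nat q) s). f_equal.
    rewrite INR_IPR. unfold IZR. ring.
Qed.

(** Here [p0^2 = 1 + q0 r0] with [q0 r0 = 4 a b c d < 0], so the monodromy is elliptic and preserves
    a definite quadratic form. The pairs [(x1, x2)] and [(y1, y2)] are shifted by the same matrix,
    so the form is periodic along each of them, hence bounded. *)
Lemma floquet_bounded :
  a * b * c * d < 0 ->
  exists B, 0 < B /\ forall s,
    Rabs (x1 s) <= B /\ Rabs (y1 s) <= B /\ Rabs (x2 s) <= B /\ Rabs (y2 s) <= B.
Proof.
  intros Hneg.
  set (p0 := a * d + b * c). set (q0 := 2 * b * d). set (r0 := 2 * a * c).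
  assert (Hqr : q0 * r0 < 0) by (unfold q0, r0; nra).
  assert (Hdet : p0 * p0 - q0 * r0 = 1).
  { unfold p0, q0, r0. pose proof half_det.
    replace 1 with ((a * d - b * c) * (a * d - b * c)) by (rewrite H; ring). ring. }
  assert (Hq : 0 < q0 * q0).
  { apply Rlt_0_sqr. intro E. rewrite E in Hqr. lra. }
  pose proof HF as (H1 & H2 & _).
  (* [q0 x1^2 - r0 x2^2] is invariant under the monodromy; multiplying it by
     [q0] makes both coefficients positive. *)
  assert (Hinv : forall u w u' w', u' = p0 * u + r0 * w -> w' = q0 * u + p0 * w ->
     q0 * q0 * (u' * u') - q0 * r0 * (w' * w') = q0 * q0 * (u * u) - q0 * r0 * (w * w)).
  { intros u w u' w' -> ->.
    replace (q0 * q0 * (u * u) - q0 * r0 * (w * w)) with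
      ((q0 * q0 * (u * u) - q0 * r0 * (w * w)) * (p0 * p0 - q0 * r0))
      by (rewrite Hdet; ring). ring. }
  destruct (periodic_bounded (fun s => q0 * q0 * (x1 s * x1 s) - q0 * r0 * (x2 s * x2 s)))
    as [B1 HB1].
  { intros s. apply continuity_pt_filterlim.
    apply (ex_derive_continuous (fun s => q0 * q0 * (x1 s * x1 s) - q0 * r0 * (x2 s * x2 s))).
    destruct (H1 s), (H2 s). auto_derive. repeat split; eexists; eassumption. }
  { intros s. destruct (fundamental_shift s) as (S1 & S2 & S3 & S4).
    apply Hinv; assumption. }
  destruct (periodic_bounded (fun s => q0 * q0 * (y1 s * y1 s) - q0 * r0 * (y2 s * y2 s)))
    as [B2 HB2].
  { intros s. apply continuity_pt_filterlim.
    apply (ex_derive_continuous (fun s => q0 * q0 * (y1 s * y1 s) - q0 * r0 * (y2 s * y2 s))).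
    destruct (H1 s), (H2 s). auto_derive. repeat split; eexists; eassumption. }
  { intros s. destruct (fundamental_shift s) as (S1 & S2 & S3 & S4).
    apply Hinv; assumption. }
  (* The crude [|z| <= 1 + z^2] suffices and spares a square root. *)
  assert (Hsq : forall k z M, 0 < k -> k * (z * z) <= M -> Rabs z <= 1 + M / k).
  { intros k z M Hk Hz.
    assert (z * z <= M / k).
    { apply Rmult_le_reg_l with k; [lra|]. replace (k * (M / k)) with M by (field; lra). lra. }
    assert (E : Rabs z * Rabs z = z * z) by (rewrite <- Rabs_mult; apply Rabs_pos_eq; nra).
    nra. }
  exists (1 + Rabs (B1 / (q0 * q0)) + Rabs (B1 / (- (q0 * r0)))
            + Rabs (B2 / (q0 * q0)) + Rabs (B2 / (- (q0 * r0)))).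
  pose proof (Rabs_pos (B1 / (q0 * q0))). pose proof (Rabs_pos (B1 / (- (q0 * r0)))).
  pose proof (Rabs_pos (B2 / (q0 * q0))). pose proof (Rabs_pos (B2 / (- (q0 * r0)))).
  split; [lra|]. intros s. specialize (HB1 s). specialize (HB2 s). simpl in HB1, HB2.
  pose proof (Rle_abs (B1 / (q0 * q0))). pose proof (Rle_abs (B1 / (- (q0 * r0)))).
  pose proof (Rle_abs (B2 / (q0 * q0))). pose proof (Rle_abs (B2 / (- (q0 * r0)))).
  assert (0 <= x1 s * x1 s) by nra. assert (0 <= x2 s * x2 s) by nra.
  assert (0 <= y1 s * y1 s) by nra. assert (0 <= y2 s * y2 s) by nra.
  repeat split.
  - apply Rle_trans with (1 + B1 / (q0 * q0)); [|lra]. apply Hsq; nra.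
  - apply Rle_trans with (1 + B2 / (q0 * q0)); [|lra]. apply Hsq; nra.
  - apply Rle_trans with (1 + B1 / (- (q0 * r0))); [|lra]. apply Hsq; nra.
  - apply Rle_trans with (1 + B2 / (- (q0 * r0))); [|lra]. apply Hsq; nra.
Qed.

Lemma floquet_unstable :
  0 < a * b * c * d ->
  exists x y mu, lin_sys p r x y /\ 1 < Rabs mu /\
    forall k, x (INR k * PI) = mu ^ k.
Proof.
  intros Hpos.
  set (p0 := a * d + b * c). set (q0 := 2 * b * d). set (r0 := 2 * a * c).
  assert (Hqr : 0 < q0 * r0) by (unfold q0, r0; nra).
  assert (Hdet : p0 * p0 - q0 * r0 = 1).
  { unfold p0, q0, r0. pose proof half_det.
    replace 1 with ((a * d - b * c) * (a * d - b * c)) by (rewrite H; ring). ring. }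
  assert (Hq : q0 <> 0) by (intro E; rewrite E in Hqr; lra).
  (* The eigenvalues of the monodromy are [p0 + e] and [p0 - e], with product 1. Giving [e] the sign
     of [p0] makes [(p0 + e)^2 >= p0^2 + e^2 = 1 + 2 q0 r0 > 1]; the eigenvector is
     [(1, e / q0)]. *)
  assert (He : exists e, e * e = q0 * r0 /\ 0 <= e * p0).
  { pose proof (sqrt_sqrt (q0 * r0) (Rlt_le _ _ Hqr)). pose proof (sqrt_pos (q0 * r0)).
    destruct (Rle_dec 0 p0).
    - exists (sqrt (q0 * r0)). split; [lra|nra].
    - exists (- sqrt (q0 * r0)). split; [lra|nra]. }
  destruct He as (e & He & Hep).
  pose proof HF as (H1 & H2 & E1 & E2 & E3 & E4).
  exists (fun s => 1 * x1 s + e / q0 * x2 s), (fun s => 1 * y1 s + e / q0 * y2 s), (p0 + e).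
  split; [apply lin_sys_comb; assumption|]. split.
  - assert (E : Rabs (p0 + e) * Rabs (p0 + e) = (p0 + e) * (p0 + e))
      by (rewrite <- Rabs_mult; apply Rabs_pos_eq; nra).
    pose proof (Rabs_pos (p0 + e)). nra.
  - assert (Hshift : forall s,
      1 * x1 (s + PI) + e / q0 * x2 (s + PI) = (p0 + e) * (1 * x1 s + e / q0 * x2 s)).
    { intros s. destruct (fundamental_shift s) as (S1 & S2 & S3 & S4).
      fold p0 q0 r0 in S1, S3. rewrite S1, S3.
      replace r0 with (e * e / q0) by (rewrite He; field; exact Hq). field. exact Hq. }
    induction k as [|k IH].
    + simpl INR. rewrite Rmult_0_l, E1, E3. simpl. ring.
    + rewrite S_INR. replace ((INR k + 1) * PI) with (INR k * PI + PI) by ring.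
      rewrite Hshift, IH. simpl. ring.
Qed.

End Floquet.


(** * Growth estimates from derivative bounds, primitives *)

Lemma abs_le_of_derive_pos (f f' g g' : R -> R) (s : R) :
  0 <= s ->
  (forall t, is_derive f t (f' t)) -> (forall t, is_derive g t (g' t)) ->
  (forall t, 0 <= t <= s -> Rabs (f' t) <= g' t) ->
  Rabs (f s - f 0) <= g s - g 0.
Proof.
  intros Hs Hf Hg Hb.
  assert (Hone : forall sg, sg = 1 \/ sg = -1 -> sg * (f s - f 0) <= g s - g 0).
  { intros sg Hsg.
    destruct (MVT_gen (fun t => g t - sg * f t) 0 s (fun t => g' t - sg * f' t))
      as [c [Hc E]].
    - intros x _. specialize (Hf x). specialize (Hg x). derive_solve. ring.
    - intros x _. apply continuity_pt_filterlim.
      apply (ex_derive_continuous (fun t => g t - sg * f t)).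
      specialize (Hf x). specialize (Hg x).
      auto_derive. repeat split; eexists; eassumption.
    - rewrite Rmin_left, Rmax_right in Hc by lra.
      specialize (Hb c Hc). apply Rabs_le_between in Hb.
      assert (0 <= g' c - sg * f' c) by (destruct Hsg; subst; lra).
      assert (0 <= (g' c - sg * f' c) * (s - 0)) by (apply Rmult_le_pos; lra).
      lra. }
  apply Rabs_le. pose proof (Hone 1 (or_introl eq_refl)).
  pose proof (Hone (-1) (or_intror eq_refl)). lra.
Qed.

(** One integration raises the power by one and divides by the new exponent; iterated, this yields
    the factorials of the exponential series. *)
Lemma abs_le_of_derive_pow (f f' : R -> R) (C : R) (n : nat) :
  f 0 = 0 -> (forall t, is_derive f t (f' t)) ->
  (forall t, Rabs (f' t) <= C * Rabs t ^ n) ->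
  forall s, Rabs (f s) <= C / INR (S n) * Rabs s ^ S n.
Proof.
  intros H0 Hf Hb.
  assert (HS : INR (S n) <> 0) by (apply not_0_INR; lia).
  assert (Hp : forall (f f' : R -> R), f 0 = 0 -> (forall t, is_derive f t (f' t)) ->
            (forall t, Rabs (f' t) <= C * Rabs t ^ n) ->
            forall s, 0 <= s -> Rabs (f s) <= C / INR (S n) * s ^ S n).
  { clear f f' H0 Hf Hb. intros f f' H0 Hf Hb s Hs.
    pose proof (abs_le_of_derive_pos f f' (fun t => C / INR (S n) * t ^ S n)
                  (fun t => C * t ^ n) s Hs Hf) as H.
    rewrite H0, Rminus_0_r in H.
    simpl (0 ^ S n) in H. rewrite Rmult_0_l, Rmult_0_r, Rminus_0_r in H.
    apply H.
    - intros t. auto_derive; [auto|]. simpl pred. change (match n with O => 1 | S _ => INR n + 1 end) with (INR (S n)). field. exact HS.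
    - intros t Ht. specialize (Hb t). rewrite (Rabs_pos_eq t) in Hb by lra. exact Hb. }
  intros s. destruct (Rle_dec 0 s) as [Hs|Hs].
  - rewrite (Rabs_pos_eq s) by lra. apply (Hp f f'); assumption.
  - rewrite (Rabs_left s) by lra.
    replace (f s) with ((fun t => f (- t)) (- s)) by (simpl; f_equal; ring).
    apply (Hp (fun t => f (- t)) (fun t => - f' (- t))).
    + rewrite Ropp_0. exact H0.
    + intros t. specialize (Hf (- t)). derive_solve. ring.
    + intros t. rewrite Rabs_Ropp. specialize (Hb (- t)). rewrite Rabs_Ropp in Hb. exact Hb.
    + lra.
Qed.

Lemma is_derive_primitive (f : R -> R) (s : R) :
  (forall t, continuous f t) -> is_derive (fun u => RInt f 0 u) s (f s).
Proof.
  intros Hc. apply (is_derive_RInt f (fun u => RInt f 0 u) 0).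
  - apply filter_forall. intros u. apply (@RInt_correct R_CompleteNormedModule).
    apply (ex_RInt_continuous (V := R_CompleteNormedModule)). intros; apply Hc.
  - apply Hc.
Qed.

(** * Existence for bounded continuous coefficients *)

Section Picard.

Variables p r : R -> R.
Variable K : R.
Hypothesis p_cont : forall t, continuous p t.
Hypothesis r_cont : forall t, continuous r t.
Hypothesis p_bound : forall t, Rabs (p t) <= K.
Hypothesis r_bound : forall t, Rabs (r t) <= K.

Variables x0 y0 : R.

(** These are the increments of the Picard iteration, not the iterates: the solution is their sum
    over [n], and only the term of index 0 carries the initial data. *)
Fixpoint picard (n : nat) : (R -> R) * (R -> R) :=
  match n with
  | O => (fun _ => x0, fun _ => y0)
  | S n => (fun s => RInt (fun t => p t * snd (picard n) t) 0 s,
            fun s => RInt (fun t => r t * fst (picard n) t) 0 s)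
  end.

Let u n := fst (picard n).
Let v n := snd (picard n).

Lemma picard_continuous n : (forall t, continuous (u n) t) /\ (forall t, continuous (v n) t).
Proof.
  induction n as [|n [IHu IHv]].
  - split; intros t; apply continuous_const.
  - split; intros t; apply (ex_derive_continuous (V := R_NormedModule)); eexists.
    + apply (is_derive_primitive (fun t => p t * v n t)).
      intros s. apply (continuous_mult p (v n)); auto.
    + apply (is_derive_primitive (fun t => r t * u n t)).
      intros s. apply (continuous_mult r (u n)); auto.
Qed.

Lemma picard_derive n t :
  is_derive (u (S n)) t (p t * v n t) /\ is_derive (v (S n)) t (r t * u n t).
Proof.
  destruct (picard_continuous n) as [Hu Hv]. split.
  - apply (is_derive_primitive (fun t => p t * v n t)).
    intros s. apply (continuous_mult p (v n)); auto.
  - apply (is_derive_primitive (fun t => r t * u n t)).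
    intros s. apply (continuous_mult r (u n)); auto.
Qed.

Lemma picard_0 n : u (S n) 0 = 0 /\ v (S n) 0 = 0.
Proof. split; apply (RInt_point (V := R_CompleteNormedModule)). Qed.

Let M := Rabs x0 + Rabs y0.

Lemma K_nonneg : 0 <= K.
Proof. pose proof (p_bound 0). pose proof (Rabs_pos (p 0)). lra. Qed.

Lemma picard_bound n :
  forall t, Rabs (u n t) <= M * (K ^ n / INR (fact n)) * Rabs t ^ n /\
            Rabs (v n t) <= M * (K ^ n / INR (fact n)) * Rabs t ^ n.
Proof.
  pose proof K_nonneg as HK.
  induction n as [|n IH].
  - intros t. simpl. pose proof (Rabs_pos x0). pose proof (Rabs_pos y0).
    unfold M, u, v; simpl. split; lra.
  - assert (HC : M * (K ^ S n / INR (fact (S n))) = (K * (M * (K ^ n / INR (fact n)))) / INR (S n)).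
    { rewrite fact_simpl, mult_INR. simpl pow. field. split.
      - apply INR_fact_neq_0. - apply not_0_INR; lia. }
    intros t. rewrite HC. split.
    + apply (abs_le_of_derive_pow (u (S n)) (fun t => p t * v n t)).
      * exact (proj1 (picard_0 n)). * intros s. exact (proj1 (picard_derive n s)).
      * intros s. rewrite Rabs_mult, Rmult_assoc.
        apply Rmult_le_compat; try apply Rabs_pos. apply p_bound. apply IH.
    + apply (abs_le_of_derive_pow (v (S n)) (fun t => r t * u n t)).
      * exact (proj2 (picard_0 n)). * intros s. exact (proj2 (picard_derive n s)).
      * intros s. rewrite Rabs_mult, Rmult_assoc.
        apply Rmult_le_compat; try apply Rabs_pos. apply r_bound. apply IH.
Qed.

Lemma CVN_R_of_bound (f : nat -> R -> R) :
  (forall n t, Rabs (f n t) <= M * (K ^ n / INR (fact n)) * Rabs t ^ n) -> CVN_R f.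
Proof.
  intros Hf rho. pose proof K_nonneg as HK.
  exists (fun n => M * (K ^ n / INR (fact n)) * rho ^ n), (M * exp (K * rho)).
  assert (HM : 0 <= M) by (unfold M; pose proof (Rabs_pos x0); pose proof (Rabs_pos y0); lra).
  assert (Hc : forall n, 0 <= M * (K ^ n / INR (fact n))).
  { intros n. apply Rmult_le_pos; [exact HM|]. apply Rdiv_le_0_compat.
    - apply pow_le, HK. - apply INR_fact_lt_0. }
  pose proof (cond_pos rho) as Hrho.
  split.
  - assert (H : is_series (fun n => Rabs (M * (K ^ n / INR (fact n)) * rho ^ n)) (M * exp (K * rho))).
    { apply (is_series_ext (fun n => scal M (scal (pow_n (K * rho) n) (/ INR (fact n))))).
      - intros n. rewrite Rabs_pos_eq.
        + unfold scal; simpl; unfold mult; simpl. rewrite pow_n_pow, Rpow_mult_distr. unfold Rdiv. ring.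
        + apply Rmult_le_pos; [apply Hc|]. apply pow_le; lra.
      - apply (is_series_scal_l (V := R_NormedModule) M). apply is_exp_Reals. }
    apply is_series_Reals in H. exact H.
  - intros n y Hy. unfold Boule in Hy. rewrite Rminus_0_r in Hy.
    eapply Rle_trans; [apply Hf|].
    apply Rmult_le_compat_l; [apply Hc|].
    apply pow_incr. split; [apply Rabs_pos | lra].
Qed.

Lemma SFL_derive (f g : nat -> R -> R) (q : R -> R)
  (cf : forall t, {l : R | Un_cv (fun N => SP f N t) l})
  (cg : forall t, {l : R | Un_cv (fun N => SP g N t) l}) :
  (forall t, continuous q t) -> (forall t, Rabs (q t) <= K) ->
  (forall n t, continuous (g n) t) -> CVN_R g ->
  (forall t, is_derive (f O) t 0) ->
  (forall n t, is_derive (f (S n)) t (q t * g n t)) ->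
  forall t, is_derive (SFL f cf) t (q t * SFL g cg t).
Proof.
  intros Hq HqK Hg HN Hf0 Hf t. pose proof K_nonneg as HK.
  assert (Hr : 0 < Rabs t + 1) by (pose proof (Rabs_pos t); lra).
  set (rho := mkposreal _ Hr).
  (* The term [f 0] is constant, so differentiating shifts the index: [S N] on the left meets [N] on
     the right. *)
  assert (HSP : forall N s, is_derive (fun s => SP f (S N) s) s (q s * SP g N s)).
  { unfold SP. induction N as [|N IH]; intros s.
    - simpl. specialize (Hf0 s). pose proof (Hf O s). derive_solve. ring.
    - pose proof (IH s) as H1. pose proof (Hf (S N) s) as H2.
      change (is_derive (fun s => sum_f_R0 (fun k => f k s) (S N) + f (S (S N)) s) s
                (q s * (sum_f_R0 (fun k => g k s) N + g (S N) s))).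
      rewrite Rmult_plus_distr_l. apply @is_derive_plus; assumption. }
  apply is_derive_Reals.
  apply (derivable_pt_lim_CVU (fun N s => SP f (S N) s) (fun N s => q s * SP g N s)
           (SFL f cf) (fun s => q s * SFL g cg s) t 0 rho).
  - unfold Boule, rho; simpl. rewrite Rminus_0_r. lra.
  - intros y n _. apply is_derive_Reals, HSP.
  - intros y _. unfold SFL. destruct (cf y) as [l Hl]. simpl.
    intros eps Heps. destruct (Hl eps Heps) as [N HN']. exists N. intros n Hn.
    apply HN'. lia.
  - pose proof (CVN_CVU g cg rho (HN rho)) as HU.
    intros eps Heps. destruct (HU (eps / (K + 1))) as [N HN'].
    { apply Rdiv_lt_0_compat; lra. }
    exists N. intros n y Hn Hy. specialize (HN' n y Hn Hy).
    rewrite <- Rmult_minus_distr_l, Rabs_mult.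
    apply Rle_lt_trans with (K * Rabs (SFL g cg y - SP g n y)).
    + apply Rmult_le_compat_r; [apply Rabs_pos|apply HqK].
    + pose proof (Rabs_pos (SFL g cg y - SP g n y)).
      set (z := Rabs (SFL g cg y - SP g n y)) in *.
      assert (E : eps = (K + 1) * (eps / (K + 1))) by (field; lra).
      rewrite E. set (e := eps / (K + 1)) in *. clearbody e z. nra.
  - intros y _. apply continuity_pt_mult.
    + apply continuity_pt_filterlim, Hq.
    + apply SFL_continuity; [exact HN|].
      intros n s. apply continuity_pt_filterlim, Hg.
Qed.

Lemma lin_sys_exists : exists x y, lin_sys p r x y /\ x 0 = x0 /\ y 0 = y0.
Proof.
  assert (Nu : CVN_R u) by (apply CVN_R_of_bound; intros n t; exact (proj1 (picard_bound n t))).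
  assert (Nv : CVN_R v) by (apply CVN_R_of_bound; intros n t; exact (proj2 (picard_bound n t))).
  pose proof (CVN_R_CVS u Nu) as cu. pose proof (CVN_R_CVS v Nv) as cv.
  exists (SFL u cu), (SFL v cv). split; [|split].
  - intros t. split.
    + apply (SFL_derive u v p); auto.
      * intros n; exact (proj2 (picard_continuous n)).
      * intros s. exact (is_derive_const (K := R_AbsRing) (V := R_NormedModule) x0 s).
      * intros n s; exact (proj1 (picard_derive n s)).
    + apply (SFL_derive v u r); auto.
      * intros n; exact (proj1 (picard_continuous n)).
      * intros s. exact (is_derive_const (K := R_AbsRing) (V := R_NormedModule) y0 s).
      * intros n s; exact (proj2 (picard_derive n s)).
  - unfold SFL. destruct (cu 0) as [l Hl]. apply (UL_sequence _ _ _ Hl).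
    intros eps Heps. exists O. intros n _.
    replace (SP u n 0) with x0. rewrite (proj2 (R_dist_refl x0 x0)); auto.
    unfold SP. induction n as [|n IH]; simpl; [reflexivity|].
    rewrite <- IH. rewrite (proj1 (picard_0 n)). ring.
  - unfold SFL. destruct (cv 0) as [l Hl]. apply (UL_sequence _ _ _ Hl).
    intros eps Heps. exists O. intros n _.
    replace (SP v n 0) with y0. rewrite (proj2 (R_dist_refl y0 y0)); auto.
    unfold SP. induction n as [|n IH]; simpl; [reflexivity|].
    rewrite <- IH. rewrite (proj2 (picard_0 n)). ring.
Qed.

End Picard.

Lemma fundamental_exists p r K :
  (forall t, continuous p t) -> (forall t, continuous r t) ->
  (forall t, Rabs (p t) <= K) -> (forall t, Rabs (r t) <= K) ->
  exists x1 y1 x2 y2, fundamental p r x1 y1 x2 y2.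
Proof.
  intros Hp Hr HpK HrK.
  destruct (lin_sys_exists p r K Hp Hr HpK HrK 1 0) as (x1 & y1 & H1 & E1 & E2).
  destruct (lin_sys_exists p r K Hp Hr HpK HrK 0 1) as (x2 & y2 & H2 & E3 & E4).
  exists x1, y1, x2, y2. split; [exact H1|split; [exact H2|auto]].
Qed.

(** * Continuous dependence *)

Lemma exp_nondecreasing (x y : R) : x <= y -> exp x <= exp y.
Proof. intros [H| ->]; [left; apply exp_increasing, H | right; reflexivity]. Qed.

(** A Gronwall estimate for the squared distance [D]. The difference solves the perturbed system
    with a forcing of size [eps * B]. In the rate [2 K + 1], the [2 K] bounds the cross term in
    [p + r], and the 1 absorbs the products with the forcing. *)
Lemma lin_sys_perturb p r x y p0 r0 x0 y0 K B h eps :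
  lin_sys p r x y -> lin_sys p0 r0 x0 y0 ->
  x 0 = x0 0 -> y 0 = y0 0 ->
  0 <= B -> 0 <= eps ->
  (forall s, 0 <= s <= h -> Rabs (p s) <= K /\ Rabs (r s) <= K) ->
  (forall s, 0 <= s <= h -> Rabs (x0 s) <= B /\ Rabs (y0 s) <= B) ->
  (forall s, 0 <= s <= h -> Rabs (p s - p0 s) <= eps /\ Rabs (r s - r0 s) <= eps) ->
  forall s, 0 <= s <= h ->
    Rabs (x s - x0 s) <= eps * (B * (1 + 2 * h * exp ((2 * K + 1) * h))) /\
    Rabs (y s - y0 s) <= eps * (B * (1 + 2 * h * exp ((2 * K + 1) * h))).
Proof.
  intros H H0 Ex Ey HB Heps HK HxB Hpr s Hs.
  set (L := 2 * K + 1).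
  assert (HK0 : 0 <= K).
  { destruct (HK s Hs). pose proof (Rabs_pos (p s)). lra. }
  set (D := fun t => (x t - x0 t) ^ 2 + (y t - y0 t) ^ 2).
  set (D' := fun t => 2 * (x t - x0 t) * (p t * y t - p0 t * y0 t)
                      + 2 * (y t - y0 t) * (r t * x t - r0 t * x0 t)).
  assert (HD : forall t, is_derive D t (D' t)).
  { intros t. destruct (H t), (H0 t). unfold D, D'. derive_solve. ring. }
  assert (Hgrow : forall t, 0 <= t <= h -> D' t <= L * D t + 2 * (eps * B) ^ 2).
  { intros t Ht. unfold D, D', L.
    destruct (HK t Ht) as [k1 k2]. destruct (HxB t Ht) as [b1 b2].
    destruct (Hpr t Ht) as [e1 e2].
    replace (p t * y t - p0 t * y0 t) with (p t * (y t - y0 t) + (p t - p0 t) * y0 t) by ring.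
    replace (r t * x t - r0 t * x0 t) with (r t * (x t - x0 t) + (r t - r0 t) * x0 t) by ring.
    assert (f1 : Rabs ((p t - p0 t) * y0 t) <= eps * B)
      by (rewrite Rabs_mult; apply Rmult_le_compat; auto using Rabs_pos).
    assert (f2 : Rabs ((r t - r0 t) * x0 t) <= eps * B)
      by (rewrite Rabs_mult; apply Rmult_le_compat; auto using Rabs_pos).
    set (u := x t - x0 t) in *. set (v := y t - y0 t) in *.
    set (w1 := (p t - p0 t) * y0 t) in *. set (w2 := (r t - r0 t) * x0 t) in *.
    apply Rabs_le_between in k1, k2, f1, f2.
    assert (w1 ^ 2 <= (eps * B) ^ 2) by (clearbody w1; nra).
    assert (w2 ^ 2 <= (eps * B) ^ 2) by (clearbody w2; nra).
    assert (2 * u * w1 <= u ^ 2 + w1 ^ 2) by (pose proof (pow2_ge_0 (u - w1)); nra).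
    assert (2 * v * w2 <= v ^ 2 + w2 ^ 2) by (pose proof (pow2_ge_0 (v - w2)); nra).
    assert (2 * u * v * (p t + r t) <= 2 * K * (u ^ 2 + v ^ 2)).
    { pose proof (pow2_ge_0 (u - v)). pose proof (pow2_ge_0 (u + v)).
      assert (0 <= (2 * K - (p t + r t)) * (u + v) ^ 2) by (apply Rmult_le_pos; lra).
      assert (0 <= (2 * K + (p t + r t)) * (u - v) ^ 2) by (apply Rmult_le_pos; lra).
      nra. }
    nra. }
  assert (HDs : D s <= 2 * (eps * B) ^ 2 * s * exp (L * s)).
  { destruct (MVT_gen (fun t => D t * exp (- (L * t)) - 2 * (eps * B) ^ 2 * t) 0 s
       (fun t => (D' t - L * D t) * exp (- (L * t)) - 2 * (eps * B) ^ 2)) as [c [Hc E]].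
    - intros t _. specialize (HD t). derive_solve. ring.
    - intros t _. apply continuity_pt_filterlim.
      apply (ex_derive_continuous (fun t => D t * exp (- (L * t)) - 2 * (eps * B) ^ 2 * t)).
      specialize (HD t). auto_derive. repeat split; eexists; eassumption.
    - rewrite Rmin_left, Rmax_right in Hc by lra.
      assert (Hc' : 0 <= c <= h) by lra. specialize (Hgrow c Hc').
      assert (D0 : D 0 = 0) by (unfold D; rewrite Ex, Ey; ring).
      rewrite D0 in E.
      assert (Hexp : exp (- (L * c)) <= 1).
      { rewrite <- exp_0. apply exp_nondecreasing. unfold L. nra. }
      pose proof (exp_pos (- (L * c))).
      assert (0 <= (eps * B) ^ 2) by apply pow2_ge_0.
      assert (Hneg : (D' c - L * D c) * exp (- (L * c)) - 2 * (eps * B) ^ 2 <= 0) by nra.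
      assert (Hs1 : D s * exp (- (L * s)) <= 2 * (eps * B) ^ 2 * s) by nra.
      replace (D s) with (D s * exp (- (L * s)) * exp (L * s)).
      + apply Rmult_le_compat_r; [left; apply exp_pos | exact Hs1].
      + rewrite Rmult_assoc, <- exp_plus. replace (- (L * s) + L * s) with 0 by ring.
        rewrite exp_0. ring. }
  set (X := exp (L * h)).
  assert (HX : exp (L * s) <= X) by (apply exp_nondecreasing; unfold L; nra).
  assert (HX0 : 0 < exp (L * s)) by apply exp_pos.
  (* The added 1 gives [Q <= Q^2], so the bound on [D] is dominated by a perfect square and the root
     can be taken. *)
  set (Q := 1 + 2 * h * X).
  assert (HQ : 1 <= Q) by (unfold Q; nra).
  assert (HDh : D s <= (eps * B * Q) ^ 2).
  { apply Rle_trans with ((eps * B) ^ 2 * Q).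
    - apply Rle_trans with (1 := HDs).
      replace (2 * (eps * B) ^ 2 * s * exp (L * s)) with ((eps * B) ^ 2 * (2 * s * exp (L * s))) by ring.
      apply Rmult_le_compat_l; [apply pow2_ge_0|].
      unfold Q. assert (s * exp (L * s) <= h * X) by (apply Rmult_le_compat; lra). lra.
    - replace ((eps * B * Q) ^ 2) with ((eps * B) ^ 2 * Q ^ 2) by ring. apply Rmult_le_compat_l; [apply pow2_ge_0|]. nra. }
  assert (HZ : 0 <= eps * B * Q) by (apply Rmult_le_pos; [apply Rmult_le_pos|]; lra).
  replace (eps * (B * Q)) with (eps * B * Q) by ring.
  unfold D in HDh.
  pose proof (pow2_ge_0 (x s - x0 s)). pose proof (pow2_ge_0 (y s - y0 s)).
  rewrite <- (Rabs_pos_eq (eps * B * Q)) by exact HZ.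
  split; apply Rsqr_le_abs_0; unfold Rsqr; lra.
Qed.


(** * Mean value and intermediate value tools *)

Lemma mean_value (f f' : R -> R) (a b : R) :
  a < b -> (forall t, a <= t <= b -> is_derive f t (f' t)) ->
  exists c, a < c < b /\ f b - f a = f' c * (b - a).
Proof.
  intros Hab H. destruct (MVT_cor2 f f' a b Hab) as [c [E Hc]].
  - intros c Hc. apply is_derive_Reals, H, Hc.
  - exists c. split; assumption.
Qed.

(** The end [b] is left out because a zero there has not been excluded when this is applied. [Rmin]
    and [Rmax] allow positivity to be carried to the left as well as to the right. *)
Lemma positive_of_nonzero (f : R -> R) (a b t : R) :
  (forall s, continuous f s) -> Rmin a b <= t <= Rmax a b -> 0 < f a ->
  (forall s, Rmin a b <= s <= Rmax a b -> s <> b -> f s <> 0) -> t <> b -> 0 < f t.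
Proof.
  intros Hc Ht Ha Hn Hb. destruct (Rlt_dec 0 (f t)) as [|Hneg]; [assumption|exfalso].
  destruct (IVT_gen f a t 0) as [s [Hs E]].
  - intros s. apply continuity_pt_filterlim, Hc.
  - rewrite Rmin_right, Rmax_left by lra. lra.
  - apply (Hn s); [|intros ->|exact E];
      revert Hs Ht; unfold Rmin, Rmax; repeat destruct Rle_dec; intros; try lra;
      apply Hb; lra.
Qed.

Lemma lin_sys_continuous p r x y :
  lin_sys p r x y -> (forall t, continuous x t) /\ (forall t, continuous y t).
Proof.
  intros H. split; intros t; destruct (H t); apply (ex_derive_continuous (V := R_NormedModule));
    eexists; eassumption.
Qed.

(** * The Hill equation of the limit oscillator [v'' + v^3 = 0] *)

(* For the solution [v = sin s(t)] of [v'' + v^3 = 0] of amplitude [1] the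
   phase satisfies [s' = lemn_speed s], and [lemn_cos s] is the velocity [v']. *)
Definition lemn_speed (s : R) : R := sqrt ((1 + sin s ^ 2) / 2).
Definition lemn_cos (s : R) : R := lemn_speed s * cos s.
Definition lame_p (s : R) : R := / lemn_speed s.
Definition lame_r (gam s : R) : R := - gam * sin s ^ 2 / lemn_speed s.

Lemma lemn_speed_pos s : 0 < lemn_speed s.
Proof. apply sqrt_lt_R0. pose proof (pow2_ge_0 (sin s)). lra. Qed.

Lemma lemn_speed_sqr s : lemn_speed s ^ 2 = (1 + sin s ^ 2) / 2.
Proof. apply pow2_sqrt. pose proof (pow2_ge_0 (sin s)). lra. Qed.

(** The equation [v'' = - v^3] written in the phase variable. *)
Lemma lemn_cos_derive s : is_derive lemn_cos s (- sin s ^ 3 / lemn_speed s).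
Proof.
  pose proof (lemn_speed_pos s) as Hg. pose proof (lemn_speed_sqr s) as Hq.
  unfold lemn_cos, lemn_speed. auto_derive.
  - pose proof (pow2_ge_0 (sin s)). simpl in *. repeat split. lra.
  - replace ((1 + sin s * (sin s * 1)) * / 2) with ((1 + sin s ^ 2) / 2) by (simpl; field).
    fold (lemn_speed s). set (g := lemn_speed s) in *.
    pose proof (sin2_cos2 s) as E. unfold Rsqr in E.
    assert (C : cos s * cos s = 1 - sin s * sin s) by lra.
    apply Rmult_eq_reg_r with g; [|lra].
    replace (- sin s ^ 3 / g * g) with (- sin s ^ 3) by (field; lra).
    transitivity (sin s * (cos s * cos s) / 2 - g ^ 2 * sin s); [field; lra|].
    rewrite C, Hq. field.
Qed.

Lemma lame_fundamental_exists gam :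
  exists x1 y1 x2 y2, fundamental lame_p (lame_r gam) x1 y1 x2 y2.
Proof.
  assert (Hb : forall s, 0 < / lemn_speed s <= 2).
  { intros s. pose proof (lemn_speed_pos s). split; [apply Rinv_0_lt_compat; assumption|].
    replace 2 with (/ / 2) by field. apply Rinv_le_contravar; [lra|].
    pose proof (lemn_speed_sqr s). pose proof (pow2_ge_0 (sin s)). nra. }
  assert (Hs : forall s, 0 <= sin s ^ 2 <= 1).
  { intros s. pose proof (SIN_bound s). nra. }
  apply (fundamental_exists _ _ (2 + 2 * Rabs gam)).
  - intros s. apply (ex_derive_continuous (V := R_NormedModule) lame_p).
    pose proof (lemn_speed_pos s) as Hg. pose proof (Hs s).
    unfold lame_p, lemn_speed in *. auto_derive. simpl in *.
    repeat split; [lra|]. apply Rgt_not_eq. exact Hg.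
  - intros s. apply (ex_derive_continuous (V := R_NormedModule) (lame_r gam)).
    pose proof (lemn_speed_pos s) as Hg. pose proof (Hs s).
    unfold lame_r, lemn_speed in *. auto_derive. simpl in *.
    repeat split; [lra|]. apply Rgt_not_eq. exact Hg.
  - intros s. unfold lame_p. specialize (Hb s). rewrite Rabs_pos_eq by lra.
    pose proof (Rabs_pos gam). lra.
  - intros s. unfold lame_r, Rdiv. rewrite 2!Rabs_mult, Rabs_Ropp.
    specialize (Hb s). specialize (Hs s). pose proof (Rabs_pos gam).
    rewrite (Rabs_pos_eq (sin s ^ 2)), (Rabs_pos_eq (/ lemn_speed s)) by lra.
    assert (0 <= Rabs gam * sin s ^ 2 <= Rabs gam) by nra. nra.
Qed.

(* Darboux-type transformation raising [nu] by [2] for [gam = nu (nu + 1) / 2];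
   it exchanges the two boundary conditions at the maximum of [v]. *)
Lemma lame_ladder nu x y :
  lin_sys lame_p (lame_r (nu * (nu + 1) / 2)) x y ->
  lin_sys lame_p (lame_r ((nu + 2) * (nu + 3) / 2))
    (fun s => (nu + 1) * lemn_cos s * x s + sin s * y s)
    (fun s => - ((nu + 1) * (nu + 2) / 2) * sin s ^ 3 * x s
              + (nu + 2) * lemn_cos s * y s).
Proof.
  intros H s. destruct (H s) as [Hx Hy]. pose proof (lemn_cos_derive s) as Hw.
  pose proof (lemn_speed_pos s). unfold lame_p, lame_r in *.
  split; derive_solve; unfold lemn_cos; field; lra.
Qed.

Definition quarter_product (x1 y1 x2 y2 : R -> R) : R :=
  x1 (PI / 2) * x2 (PI / 2) * y1 (PI / 2) * y2 (PI / 2).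

(** The value [sg = 1] is the unstable case and [sg = -1] the stable one. Fundamental pairs are
    unique by [fundamental_repr], so the quantifier speaks of a single product. *)
Definition lame_sign (sg gam : R) : Prop :=
  forall x1 y1 x2 y2, fundamental lame_p (lame_r gam) x1 y1 x2 y2 ->
  0 < sg * quarter_product x1 y1 x2 y2.

Lemma lemn_cos_PI2 : lemn_cos (PI / 2) = 0.
Proof. unfold lemn_cos. rewrite cos_PI2. ring. Qed.

Lemma lemn_cos_0 : 0 < lemn_cos 0.
Proof. unfold lemn_cos. rewrite cos_0. pose proof (lemn_speed_pos 0). lra. Qed.

(** At 0 the sine vanishes and the ladder is diagonal, with entries [(nu + 1) w0] and [(nu + 2) w0],
    positive since [nu > -1]. At [PI / 2] [lemn_cos] vanishes and the ladder maps [(x, y)] to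
    [(y, - kap x)]. So up to positive factors [A, B, C, D] are [c, d, - a, - b], and the two minus
    signs cancel in the product. *)
Lemma lame_sign_ladder sg nu :
  -1 < nu -> lame_sign sg (nu * (nu + 1) / 2) ->
  lame_sign sg ((nu + 2) * (nu + 3) / 2).
Proof.
  intros Hnu IH X1 Y1 X2 Y2 HF.
  destruct (lame_fundamental_exists (nu * (nu + 1) / 2)) as (x1 & y1 & x2 & y2 & hF).
  specialize (IH _ _ _ _ hF). pose proof hF as (h1 & h2 & e1 & e2 & e3 & e4).
  destruct (fundamental_repr _ _ _ _ _ _ _ _ HF (lame_ladder nu _ _ h1) (PI / 2)) as [A1 A2].
  destruct (fundamental_repr _ _ _ _ _ _ _ _ HF (lame_ladder nu _ _ h2) (PI / 2)) as [B1 B2].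
  rewrite sin_PI2, lemn_cos_PI2, sin_0, e1, e2 in A1, A2.
  rewrite sin_PI2, lemn_cos_PI2, sin_0, e3, e4 in B1, B2.
  pose proof lemn_cos_0 as Hw0. set (w0 := lemn_cos 0) in *.
  unfold quarter_product in *.
  set (a := x1 (PI / 2)) in *. set (b := x2 (PI / 2)) in *.
  set (c := y1 (PI / 2)) in *. set (d := y2 (PI / 2)) in *.
  set (A := X1 (PI / 2)) in *. set (B := X2 (PI / 2)) in *.
  set (C := Y1 (PI / 2)) in *. set (D := Y2 (PI / 2)) in *.
  set (kap := (nu + 1) * (nu + 2) / 2) in *.
  assert (Hkap : 0 < kap) by (unfold kap; nra).
  assert (EA : A * ((nu + 1) * w0) = c) by lra.
  assert (EC : C * ((nu + 1) * w0) = - kap * a) by lra.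
  assert (EB : B * ((nu + 2) * w0) = d) by lra.
  assert (ED : D * ((nu + 2) * w0) = - kap * b) by lra.
  assert (E : sg * (A * B * C * D) * (((nu + 1) * w0) * ((nu + 2) * w0)) ^ 2
              = kap ^ 2 * (sg * (a * b * c * d))).
  { transitivity (sg * ((A * ((nu + 1) * w0)) * (B * ((nu + 2) * w0)) *
                        (C * ((nu + 1) * w0)) * (D * ((nu + 2) * w0)))); [ring|].
    rewrite EA, EB, EC, ED. ring. }
  assert (Hk : 0 < ((nu + 1) * w0) * ((nu + 2) * w0))
    by (apply Rmult_lt_0_compat; apply Rmult_lt_0_compat; lra).
  assert (0 < kap ^ 2 * (sg * (a * b * c * d)))
    by (apply Rmult_lt_0_compat; [apply pow_lt|]; assumption).
  apply Rmult_lt_reg_r with ((((nu + 1) * w0) * ((nu + 2) * w0)) ^ 2).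
  - apply pow_lt, Hk. - rewrite Rmult_0_l, E. assumption.
Qed.

Lemma sin_pos_quarter s : 0 < s <= PI / 2 -> 0 < sin s.
Proof. intros. pose proof PI_RGT_0. apply sin_gt_0; lra. Qed.

(** For [gam < 0] the product [x y] increases along every nontrivial solution, and it vanishes at 0
    for both fundamental ones; hence [a c > 0] and [b d > 0]. *)
Lemma lame_sign_neg gam : gam < 0 -> lame_sign 1 gam.
Proof.
  intros Hgam x1 y1 x2 y2 HF. pose proof PI_RGT_0 as HPI.
  pose proof (fundamental_det _ _ _ _ _ _ HF) as W.
  destruct HF as (H1 & H2 & E1 & E2 & E3 & E4).
  assert (Hprod : forall x y, lin_sys lame_p (lame_r gam) x y -> x 0 * y 0 = 0 ->
            (forall s, x s <> 0 \/ y s <> 0) -> 0 < x (PI / 2) * y (PI / 2)).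
  { intros x y H H0 Hn.
    destruct (mean_value (fun s => x s * y s)
      (fun s => (y s ^ 2 + - gam * sin s ^ 2 * x s ^ 2) / lemn_speed s) 0 (PI / 2))
      as [s [Hs E]]; [lra| |].
    - intros s _. destruct (H s). pose proof (lemn_speed_pos s).
      unfold lame_p, lame_r in *. derive_solve. field. lra.
    - rewrite H0, !Rminus_0_r in E. rewrite E.
      apply Rmult_lt_0_compat; [|lra].
      apply Rdiv_lt_0_compat; [|apply lemn_speed_pos].
      pose proof (sin_pos_quarter s ltac:(lra)) as Hsin.
      assert (0 < - gam * sin s ^ 2) by (apply Rmult_lt_0_compat; [lra|apply pow_lt, Hsin]).
      pose proof (pow2_ge_0 (x s)). pose proof (pow2_ge_0 (y s)).
      destruct (Hn s) as [Hx|Hy].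
      + pose proof (pow2_gt_0 _ Hx). nra.
      + pose proof (pow2_gt_0 _ Hy). nra. }
  assert (P1 : 0 < x1 (PI / 2) * y1 (PI / 2)).
  { apply Hprod; [assumption|rewrite E2; ring|].
    intros s. specialize (W s). destruct (Req_dec (x1 s) 0) as [Z|]; [|auto].
    right. intro Z'. rewrite Z, Z' in W. lra. }
  assert (P2 : 0 < x2 (PI / 2) * y2 (PI / 2)).
  { apply Hprod; [assumption|rewrite E3; ring|].
    intros s. specialize (W s). destruct (Req_dec (x2 s) 0) as [Z|]; [|auto].
    right. intro Z'. rewrite Z, Z' in W. lra. }
  unfold quarter_product.
  replace (1 * (x1 (PI / 2) * x2 (PI / 2) * y1 (PI / 2) * y2 (PI / 2)))
    with ((x1 (PI / 2) * y1 (PI / 2)) * (x2 (PI / 2) * y2 (PI / 2))) by ring.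
  apply Rmult_lt_0_compat; assumption.
Qed.

Lemma sum_squares_zero k x y : 0 < k -> x ^ 2 + k * y ^ 2 = 0 -> x = 0 /\ y = 0.
Proof.
  intros Hk E. pose proof (pow2_ge_0 x). pose proof (pow2_ge_0 y).
  assert (y ^ 2 = 0) by nra. assert (x ^ 2 = 0) by nra.
  split; apply Rsqr_0_uniq; unfold Rsqr; lra.
Qed.

(* Sturm comparison with the explicit solutions [lemn_cos] (for [gam = 3]) and
   [sin] (for [gam = 1]), which are positive on the open quarter period. *)
Lemma lame_sign_unit gam : 0 < gam < 1 -> lame_sign (-1) gam.
Proof.
  intros Hgam x1 y1 x2 y2 HF. pose proof PI_RGT_0 as HPI.
  pose proof (fundamental_det _ _ _ _ _ _ HF) as W.
  destruct HF as (H1 & H2 & E1 & E2 & E3 & E4).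
  pose proof lemn_cos_PI2 as wh. pose proof sin_PI2 as vh. pose proof lemn_cos_0 as w0.
  assert (Hcos : forall s, 0 <= s < PI / 2 -> 0 < cos s) by (intros; apply cos_gt_0; lra).
  assert (Hx1nz : forall s, 0 < s < PI / 2 -> x1 s <> 0).
  { intros s1 Hs1 Z.
    (* Picone's identity: with [w = lemn_cos] and time derivatives, this is [x^2 (x'/x - w'/w)]. It
       vanishes at 0 and at a zero of [x1], while its derivative is a sum of squares, so somewhere
       in between both [x1] and [y1] would vanish. *)
    destruct (mean_value (fun s => x1 s * y1 s + x1 s ^ 2 * sin s ^ 3 / lemn_cos s)
      (fun s => ((y1 s + x1 s * sin s ^ 3 / lemn_cos s) ^ 2
                 + (3 - gam) * sin s ^ 2 * x1 s ^ 2) / lemn_speed s) 0 s1)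
      as [s [Hs E]]; [lra| |].
    - intros s Hs. destruct (H1 s). pose proof (lemn_speed_pos s).
      pose proof (Hcos s ltac:(lra)). pose proof (lemn_cos_derive s) as Hw.
      assert (lemn_cos s <> 0)
        by (apply Rgt_not_eq; unfold lemn_cos; apply Rmult_lt_0_compat; lra).
      unfold lame_p, lame_r in *. derive_solve; [assumption|].
      unfold lemn_cos in *. field. split; lra.
    - rewrite Z, E2, sin_0 in E.
      assert (Hz : ((y1 s + x1 s * sin s ^ 3 / lemn_cos s) ^ 2
                 + (3 - gam) * sin s ^ 2 * x1 s ^ 2) / lemn_speed s = 0).
      { apply Rmult_eq_reg_r with (s1 - 0); [|lra]. rewrite <- E. simpl. unfold Rdiv. ring. }
      pose proof (lemn_speed_pos s).
      apply (f_equal (fun z => z * lemn_speed s)) in Hz. unfold Rdiv in Hz.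
      rewrite Rmult_assoc, Rinv_l, Rmult_1_r, Rmult_0_l in Hz by lra.
      pose proof (sin_pos_quarter s ltac:(lra)) as Hsin.
      apply sum_squares_zero in Hz.
      + destruct Hz as [Zy Zx]. rewrite Zx in Zy. specialize (W s).
        rewrite Zx in W. replace (y1 s) with 0 in W by lra. lra.
      + apply Rmult_lt_0_compat; [lra|apply pow_lt, Hsin]. }
  assert (Hx1 : forall s, 0 <= s < PI / 2 -> 0 < x1 s).
  { intros s Hs. apply (positive_of_nonzero x1 0 (PI / 2)).
    - apply (lin_sys_continuous _ _ _ _ H1).
    - rewrite Rmin_left, Rmax_right; lra.
    - rewrite E1; lra.
    - rewrite Rmin_left, Rmax_right by lra. intros u Hu Hub.
      destruct (Req_dec u 0) as [->|]; [rewrite E1; lra|]. apply Hx1nz. lra.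
    - lra. }
  (* The Wronskian of [x1] with [lemn_cos] starts at 0, increases, and equals [x1] at [PI / 2]. *)
  assert (Pa : 0 < x1 (PI / 2)).
  { destruct (mean_value (fun s => y1 s * lemn_cos s + x1 s * sin s ^ 3)
      (fun s => (3 - gam) * sin s ^ 2 * x1 s * cos s) 0 (PI / 2))
      as [s [Hs E]]; [lra| |].
    - intros s Hs. destruct (H1 s). pose proof (lemn_speed_pos s).
      pose proof (lemn_cos_derive s) as Hw.
      unfold lame_p, lame_r in *. derive_solve. unfold lemn_cos in *. field. lra.
    - rewrite vh, wh, E2, sin_0 in E.
      pose proof (sin_pos_quarter s ltac:(lra)) as Hsin.
      pose proof (Hcos s ltac:(lra)). pose proof (Hx1 s ltac:(lra)).
      assert (0 < (3 - gam) * sin s ^ 2 * x1 s * cos s)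
        by (repeat apply Rmult_lt_0_compat; try assumption; lra).
      assert (0 < (3 - gam) * sin s ^ 2 * x1 s * cos s * (PI / 2 - 0))
        by (apply Rmult_lt_0_compat; lra).
      simpl in E. lra. }
  assert (Pc : y1 (PI / 2) < 0).
  { destruct (mean_value y1 (fun s => lame_r gam s * x1 s) 0 (PI / 2))
      as [s [Hs E]]; [lra|intros s _; apply H1|].
    pose proof (sin_pos_quarter s ltac:(lra)) as Hsin. pose proof (Hx1 s ltac:(lra)).
    assert (0 < gam * sin s ^ 2 / lemn_speed s * x1 s * (PI / 2)).
    { apply Rmult_lt_0_compat; [|lra]. apply Rmult_lt_0_compat; [|assumption].
      apply Rdiv_lt_0_compat; [|apply lemn_speed_pos].
      apply Rmult_lt_0_compat; [lra|apply pow_lt, Hsin]. }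
    rewrite E2 in E. unfold lame_r in E.
    replace (- gam * sin s ^ 2 / lemn_speed s * x1 s * (PI / 2 - 0))
      with (- (gam * sin s ^ 2 / lemn_speed s * x1 s * (PI / 2))) in E by (unfold Rdiv; ring).
    lra. }
  (* Reduction of order: the Wronskian being 1, the quotient [x2 / x1] increases from 0. *)
  assert (Pb : 0 < x2 (PI / 2)).
  { destruct (mean_value (fun s => x2 s / x1 s) (fun s => / lemn_speed s / x1 s ^ 2) 0 (PI / 2))
      as [s [Hs E]]; [lra| |].
    - intros s Hs. destruct (H1 s), (H2 s).
      assert (0 < x1 s).
      { destruct (Req_dec s (PI / 2)) as [->|]; [assumption|apply Hx1; lra]. }
      pose proof (lemn_speed_pos s). specialize (W s).
      unfold lame_p in *. derive_solve; [lra|].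
      transitivity ((x1 s * y2 s - y1 s * x2 s) / (lemn_speed s * x1 s ^ 2)); [field; lra|].
      rewrite W. field. lra.
    - rewrite E3 in E. pose proof (Hx1 s ltac:(lra)).
      assert (0 < / lemn_speed s / x1 s ^ 2 * (PI / 2 - 0)).
      { apply Rmult_lt_0_compat; [|lra]. apply Rdiv_lt_0_compat.
        - apply Rinv_0_lt_compat, lemn_speed_pos. - apply pow_lt; assumption. }
      assert (E' : x2 (PI / 2) = x1 (PI / 2) * (x2 (PI / 2) / x1 (PI / 2))) by (field; lra).
      rewrite E'. apply Rmult_lt_0_compat; [assumption|]. unfold Rdiv in E |- *. lra. }
  (* The entry [d] is also the value at 0 of the solution [(X, Y)] with data [(1, 0)] at [PI / 2].
     The two previous arguments are repeated backwards from [PI / 2] for [X], now against [sin],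
     whose velocity [lemn_cos] vanishes there. *)
  assert (Pd : 0 < y2 (PI / 2)).
  { set (c := y1 (PI / 2)) in *. set (d := y2 (PI / 2)) in *.
    set (X := fun s => d * x1 s + - c * x2 s). set (Y := fun s => d * y1 s + - c * y2 s).
    assert (HX : lin_sys lame_p (lame_r gam) X Y) by (apply lin_sys_comb; assumption).
    assert (Xh : X (PI / 2) = 1) by (unfold X; rewrite <- (W (PI / 2)); fold c d; ring).
    assert (Yh : Y (PI / 2) = 0) by (unfold Y; fold c d; ring).
    assert (X0 : X 0 = d) by (unfold X; rewrite E1, E3; ring).
    assert (Hnz : forall s, X s = 0 -> Y s <> 0).
    { intros s ZX ZY. unfold X in ZX. unfold Y in ZY.
      assert (c = 0); [|lra].
      replace c with (c * (x1 s * y2 s - y1 s * x2 s)) by (rewrite W; ring).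
      replace (c * (x1 s * y2 s - y1 s * x2 s)) with
        (- x1 s * (d * y1 s + - c * y2 s) + y1 s * (d * x1 s + - c * x2 s)) by ring.
      rewrite ZX, ZY. ring. }
    clearbody X Y.
    assert (HXnz : forall s, 0 < s < PI / 2 -> X s <> 0).
    { intros s1 Hs1 Z.
      destruct (mean_value (fun s => X s * Y s - X s ^ 2 * lemn_cos s / sin s)
        (fun s => ((Y s - X s * lemn_cos s / sin s) ^ 2
                   + (1 - gam) * sin s ^ 2 * X s ^ 2) / lemn_speed s) s1 (PI / 2))
        as [s [Hs E]]; [lra| |].
      - intros s Hs. destruct (HX s). pose proof (lemn_speed_pos s).
        pose proof (lemn_cos_derive s) as Hw.
        pose proof (sin_pos_quarter s ltac:(lra)) as Hsin.
        unfold lame_p, lame_r in *. derive_solve; [lra|].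
        unfold lemn_cos in *. field. split; lra.
      - rewrite Z, Xh, Yh, wh, vh in E.
        assert (Hz : ((Y s - X s * lemn_cos s / sin s) ^ 2
                   + (1 - gam) * sin s ^ 2 * X s ^ 2) / lemn_speed s = 0).
        { apply Rmult_eq_reg_r with (PI / 2 - s1); [|lra]. rewrite <- E.
          simpl. unfold Rdiv. ring. }
        pose proof (lemn_speed_pos s).
        apply (f_equal (fun z => z * lemn_speed s)) in Hz. unfold Rdiv in Hz.
        rewrite Rmult_assoc, Rinv_l, Rmult_1_r, Rmult_0_l in Hz by lra.
        pose proof (sin_pos_quarter s ltac:(lra)) as Hsin.
        apply sum_squares_zero in Hz.
        + destruct Hz as [Zy Zx]. apply (Hnz s Zx). rewrite Zx in Zy. lra.
        + apply Rmult_lt_0_compat; [lra|apply pow_lt, Hsin]. }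
    assert (HXp : forall s, 0 < s <= PI / 2 -> 0 < X s).
    { intros s Hs. apply (positive_of_nonzero X (PI / 2) 0).
      - apply (lin_sys_continuous _ _ _ _ HX).
      - rewrite Rmin_right, Rmax_left; lra.
      - rewrite Xh; lra.
      - rewrite Rmin_right, Rmax_left by lra. intros u Hu Hub.
        destruct (Req_dec u (PI / 2)) as [->|]; [rewrite Xh; lra|]. apply HXnz. lra.
      - lra. }
    destruct (mean_value (fun s => Y s * sin s - X s * lemn_cos s)
      (fun s => (1 - gam) * sin s ^ 3 * X s / lemn_speed s) 0 (PI / 2))
      as [s [Hs E]]; [lra| |].
    - intros s Hs. destruct (HX s). pose proof (lemn_speed_pos s).
      pose proof (lemn_cos_derive s) as Hw.
      unfold lame_p, lame_r in *. derive_solve. unfold lemn_cos in *. field. lra.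
    - rewrite vh, wh, Xh, Yh, X0, sin_0 in E.
      pose proof (sin_pos_quarter s ltac:(lra)) as Hsin. pose proof (HXp s ltac:(lra)).
      assert (0 < (1 - gam) * sin s ^ 3 * X s / lemn_speed s * (PI / 2 - 0)).
      { apply Rmult_lt_0_compat; [|lra].
        apply Rdiv_lt_0_compat; [|apply lemn_speed_pos].
        repeat apply Rmult_lt_0_compat; try assumption; lra. }
      nra. }
  unfold quarter_product.
  replace (-1 * (x1 (PI / 2) * x2 (PI / 2) * y1 (PI / 2) * y2 (PI / 2)))
    with (x1 (PI / 2) * x2 (PI / 2) * (- y1 (PI / 2)) * y2 (PI / 2)) by ring.
  repeat apply Rmult_lt_0_compat; lra.
Qed.

Lemma lame_sign_iter sg nu k :
  -1 < nu -> lame_sign sg (nu * (nu + 1) / 2) ->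
  lame_sign sg ((nu + 2 * INR k) * (nu + 2 * INR k + 1) / 2).
Proof.
  intros Hnu H. induction k as [|k IH].
  - simpl INR. replace (nu + 2 * 0) with nu by ring. exact H.
  - rewrite S_INR.
    replace ((nu + 2 * (INR k + 1)) * (nu + 2 * (INR k + 1) + 1) / 2)
      with ((nu + 2 * INR k + 2) * (nu + 2 * INR k + 3) / 2) by field.
    apply lame_sign_ladder; [|exact IH]. pose proof (pos_INR k). lra.
Qed.

Lemma lame_root (u v gam : R) :
  0 <= u -> u * (u + 1) / 2 < gam < v * (v + 1) / 2 -> 0 <= v ->
  exists nu, gam = nu * (nu + 1) / 2 /\ u < nu < v.
Proof.
  intros Hu Hg Hv. exists ((-1 + sqrt (1 + 8 * gam)) / 2).
  assert (Hpos : 0 <= 1 + 8 * gam) by nra.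
  pose proof (sqrt_sqrt _ Hpos) as E. pose proof (sqrt_pos (1 + 8 * gam)) as P.
  set (q := sqrt (1 + 8 * gam)) in *. clearbody q.
  split; [nra|]. split; nra.
Qed.

(** The ends of the interval of index [k] are [nu (nu + 1) / 2] at [nu = 2 k + 1] and
    [nu = 2 k + 2], so [k + 1] ladder steps lead down to [-1 < nu < 0]. For [I_S] the range is
    [2 k < nu < 2 k + 1], and [k] steps lead to [0 < nu < 1]. *)
Lemma lame_sign_U gam : I_U gam -> lame_sign 1 gam.
Proof.
  intros [k Hk]. pose proof (pos_INR k).
  destruct (lame_root (2 * INR k + 1) (2 * INR k + 2) gam) as (nu & -> & Hnu);
    [lra|split; nra|lra|].
  replace (nu * (nu + 1) / 2) with
    ((nu - 2 * INR (S k) + 2 * INR (S k)) * (nu - 2 * INR (S k) + 2 * INR (S k) + 1) / 2) by field.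
  apply lame_sign_iter; rewrite S_INR; [lra|].
  apply lame_sign_neg. nra.
Qed.

Lemma lame_sign_S gam : I_S gam -> lame_sign (-1) gam.
Proof.
  intros [k Hk]. pose proof (pos_INR k).
  destruct (lame_root (2 * INR k) (2 * INR k + 1) gam) as (nu & -> & Hnu);
    [lra|split; nra|lra|].
  replace (nu * (nu + 1) / 2) with
    ((nu - 2 * INR k + 2 * INR k) * (nu - 2 * INR k + 2 * INR k + 1) / 2) by field.
  apply lame_sign_iter; [lra|].
  apply lame_sign_unit. split; nra.
Qed.


(** * Phase representation of the Duffing oscillator *)

Lemma polar_angle x y : x ^ 2 + y ^ 2 = 1 -> exists s, sin s = x /\ cos s = y.
Proof.
  intros E. assert (Hx : -1 <= x <= 1) by (split; nra).
  assert (Hsq : sqrt (1 - x * x) = Rabs y).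
  { replace (1 - x * x) with (Rsqr y) by (unfold Rsqr; lra). apply sqrt_Rsqr_abs. }
  destruct (Rle_dec 0 y) as [Hy|Hy].
  - exists (asin x). split; [apply sin_asin, Hx|].
    rewrite cos_asin by exact Hx. unfold Rsqr. rewrite Hsq. apply Rabs_pos_eq, Hy.
  - exists (PI - asin x). split.
    + rewrite sin_minus, sin_PI, cos_PI, sin_asin by exact Hx. ring.
    + rewrite cos_minus, sin_PI, cos_PI, cos_asin by exact Hx.
      unfold Rsqr. rewrite Hsq, Rabs_left by lra. ring.
Qed.

Definition phase_speed (al be L s : R) : R :=
  sqrt (al + be * L * (1 + sin s ^ 2) / 2).

(** Energy conservation factors as [Th'^2 = (L - Th^2) V^2] with [V > 0]. With [Z = Th' / V] the
    point [(Th, Z)] turns on the circle of radius [sqrt L] with angular speed [V]. Integrating [V]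
    gives a global phase, with no inversion of the sine at turning points. *)
Lemma duffing_phase al be L (Th dTh : R -> R) :
  0 < al -> 0 < be -> 0 < L ->
  (forall t, is_derive Th t (dTh t)) ->
  (forall t, is_derive dTh t (- (al * Th t + be * Th t ^ 3))) ->
  dTh 0 ^ 2 / 2 + al / 2 * Th 0 ^ 2 + be / 4 * Th 0 ^ 4 = al / 2 * L + be / 4 * L ^ 2 ->
  exists S : R -> R,
    (forall t, is_derive S t (phase_speed al be L (S t))) /\
    (forall t, Th t ^ 2 = L * sin (S t) ^ 2).
Proof.
  intros Hal Hbe HL HT HdT HE.
  set (V := fun t => sqrt (al + be * (L + Th t ^ 2) / 2)).
  assert (Harg : forall t, 0 < al + be * (L + Th t ^ 2) / 2).
  { intros t. pose proof (pow2_ge_0 (Th t)).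
    assert (0 <= be * (L + Th t ^ 2)) by (apply Rmult_le_pos; lra). lra. }
  assert (HV : forall t, 0 < V t) by (intros; apply sqrt_lt_R0, Harg).
  assert (HV2 : forall t, V t ^ 2 = al + be * (L + Th t ^ 2) / 2)
    by (intros; apply pow2_sqrt; left; apply Harg).
  assert (Hen : forall t, dTh t ^ 2 = (L - Th t ^ 2) * V t ^ 2).
  { intros t. rewrite HV2.
    pose proof (is_derive_0_const
      (fun t => dTh t ^ 2 / 2 + al / 2 * Th t ^ 2 + be / 4 * Th t ^ 4)) as Hc.
    assert (Hd : forall t, is_derive
      (fun t => dTh t ^ 2 / 2 + al / 2 * Th t ^ 2 + be / 4 * Th t ^ 4) t 0).
    { intros u. specialize (HT u). specialize (HdT u). derive_solve. field. }
    specialize (Hc Hd t 0). cbv beta in Hc. rewrite HE in Hc. lra. }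
  set (Z := fun t => dTh t / V t).
  assert (HTZ : forall t, is_derive Th t (V t * Z t)).
  { intros t. unfold Z. replace (V t * (dTh t / V t)) with (dTh t); [apply HT|].
    field. apply Rgt_not_eq, HV. }
  assert (HdV : forall t, is_derive V t (be * Th t * dTh t / (2 * V t))).
  { intros t. specialize (HT t). specialize (Harg t). pose proof (HV t). unfold V in *.
    auto_derive.
    - split; [eexists; eassumption|]. split; [|exact I]. simpl in *. lra.
    - erewrite Derive_eta by eassumption.
      replace (al + be * (L + Th t * (Th t * 1)) * / 2) with (al + be * (L + Th t ^ 2) / 2)
        by (simpl; field).
      field. lra. }
  assert (HZd : forall t, is_derive Z t (- V t * Th t)).
  { intros t. specialize (HdT t). specialize (HdV t). pose proof (HV t). pose proof (Hen t) as En.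
    pose proof (HV2 t) as V2. unfold Z.
    derive_solve; [lra|]. set (v := V t) in *. set (z := Th t) in *. set (w := dTh t) in *.
    transitivity (- (al * z + be * z ^ 3) / v - be * z * w ^ 2 / (2 * v ^ 3)); [field; lra|].
    rewrite En.
    transitivity (- z * (al + be * (L + z ^ 2) / 2) / v); [field; lra|].
    rewrite <- V2. field. lra. }
  assert (Hcirc : forall t, Th t ^ 2 + Z t ^ 2 = L).
  { intros t. unfold Z. pose proof (HV t).
    replace ((dTh t / V t) ^ 2) with (dTh t ^ 2 / V t ^ 2) by (field; lra).
    rewrite Hen. field. lra. }
  set (A := sqrt L).
  assert (HA : 0 < A) by (apply sqrt_lt_R0, HL).
  assert (HA2 : A ^ 2 = L) by (apply pow2_sqrt; lra).
  destruct (polar_angle (Th 0 / A) (Z 0 / A)) as (s0 & Hs & Hc).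
  { replace ((Th 0 / A) ^ 2 + (Z 0 / A) ^ 2) with ((Th 0 ^ 2 + Z 0 ^ 2) / A ^ 2) by (field; lra).
    rewrite Hcirc, HA2. field. lra. }
  set (S := fun t => s0 + RInt V 0 t).
  assert (HS : forall t, is_derive S t (V t)).
  { intros t. unfold S. rewrite <- (Rplus_0_l (V t)). apply @is_derive_plus.
    - apply @is_derive_const.
    - apply is_derive_primitive. intros u.
      apply (ex_derive_continuous (V := R_NormedModule)). eexists; apply HdV. }
  (* [(Th, Z)] and [A (sin S, cos S)] solve the same rotation equation. *)
  assert (Hid : forall t, (Th t - A * sin (S t)) ^ 2 + (Z t - A * cos (S t)) ^ 2 = 0).
  { intros t.
    rewrite (is_derive_0_const
      (fun t => (Th t - A * sin (S t)) ^ 2 + (Z t - A * cos (S t)) ^ 2)) with (b := 0).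
    - assert (S0 : S 0 = s0).
      { unfold S. rewrite RInt_point. apply Rplus_0_r. }
      cbv beta. rewrite S0, Hs, Hc. field. lra.
    - intros u. specialize (HS u). specialize (HTZ u). specialize (HZd u).
      derive_solve. ring. }
  assert (HTh : forall t, Th t = A * sin (S t)).
  { intros t. specialize (Hid t).
    pose proof (pow2_ge_0 (Th t - A * sin (S t))). pose proof (pow2_ge_0 (Z t - A * cos (S t))).
    assert (Th t - A * sin (S t) = 0); [|lra]. apply Rsqr_0_uniq. unfold Rsqr. lra. }
  assert (HTh2 : forall t, Th t ^ 2 = L * sin (S t) ^ 2).
  { intros t. rewrite HTh, <- HA2. ring. }
  exists S. split; [|exact HTh2].
  intros t. replace (phase_speed al be L (S t)) with (V t); [apply HS|].
  unfold V, phase_speed. f_equal. rewrite HTh2. field.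
Qed.

(** * Transfer of the Floquet alternative to the original time *)

Lemma hill_solution_is_derive a xi :
  hill_solution a xi ->
  forall t, is_derive xi t (Derive xi t) /\ is_derive (Derive xi) t (- a t * xi t).
Proof.
  intros [Hd He] t. destruct (Hd t) as [H1 H2]. split.
  - apply Derive_correct, H1.
  - replace (- a t * xi t) with (Derive (Derive xi) t).
    + apply Derive_correct. exact H2.
    + specialize (He t). change (Derive_n xi 2 t) with (Derive (Derive xi) t) in He. lra.
Qed.

Lemma is_derive_hill_solution a xi dxi :
  (forall t, is_derive xi t (dxi t)) ->
  (forall t, is_derive dxi t (- a t * xi t)) ->
  hill_solution a xi /\ forall t, Derive xi t = dxi t.
Proof.
  intros H1 H2. assert (E : forall t, Derive xi t = dxi t)
    by (intros; apply is_derive_unique, H1).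
  split; [|exact E]. split.
  - intros t. split; [eexists; apply H1|].
    apply (ex_derive_ext dxi); [intros; symmetry; apply E|]. eexists; apply H2.
  - intros t. change (Derive_n xi 2 t) with (Derive (Derive xi) t).
    rewrite (Derive_ext _ dxi) by apply E. rewrite (is_derive_unique _ _ _ (H2 t)). ring.
Qed.

Section Transfer.

Variables (p r G S a : R -> R) (lam : R).
Hypothesis lam_pos : 0 < lam.
Hypothesis S_derive : forall t, is_derive S t (G (S t)).
Hypothesis p_G : forall s, p s * G s = lam.
Hypothesis r_G : forall t, r (S t) * G (S t) * lam = - a t.

(** Back in time [t], [x] is a solution of the Hill equation and [y] its velocity divided by
    [lam]. *)
Lemma lin_sys_phase x y :
  lin_sys p r x y ->
  lin_sys (fun _ => lam) (fun t => - a t / lam) (fun t => x (S t)) (fun t => y (S t)).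
Proof.
  intros H t. pose proof (S_derive t) as HS. destruct (H (S t)) as [Hx Hy]. split.
  - derive_solve. rewrite <- (p_G (S t)). ring.
  - derive_solve. rewrite <- r_G. field. lra.
Qed.

Lemma hill_stable x1 y1 x2 y2 B :
  fundamental p r x1 y1 x2 y2 -> 0 < B ->
  (forall s, Rabs (x1 s) <= B /\ Rabs (y1 s) <= B /\ Rabs (x2 s) <= B /\ Rabs (y2 s) <= B) ->
  zero_stable a.
Proof.
  intros HF HB Hb t0 eps Heps.
  (* Two basis terms, each with a coefficient at most [dl (1 + / lam) B] and a factor at most [B];
     [1 + lam] covers both [xi] and its derivative [lam * y]. *)
  set (M := 2 * B ^ 2 * (1 + / lam) * (1 + lam)).
  assert (Hil : 0 < / lam) by (apply Rinv_0_lt_compat, lam_pos).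
  assert (HM : 0 < M).
  { unfold M. repeat apply Rmult_lt_0_compat; try lra. }
  exists (eps / (2 * M)). split; [apply Rdiv_lt_0_compat; lra|].
  intros xi Hxi Hx0 Hy0 t _.
  pose proof (fundamental_det _ _ _ _ _ _ HF (S t0)) as W.
  destruct HF as (H1 & H2 & _).
  assert (Hsys : lin_sys (fun _ => lam) (fun t => - a t / lam) xi (fun t => Derive xi t / lam)).
  { intros u. destruct (hill_solution_is_derive _ _ Hxi u) as [D1 D2]. split.
    - replace (lam * (Derive xi u / lam)) with (Derive xi u) by (field; lra). exact D1.
    - apply (is_derive_ext (fun u => / lam * Derive xi u)); [intros v; apply Rmult_comm|].
      replace (- a u / lam * xi u) with (/ lam * (- a u * xi u)) by (field; lra).
      apply (is_derive_scal (Derive xi)), D2. }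
  destruct (lin_sys_repr _ _ _ _ _ _ _ _ t0 (lin_sys_phase _ _ H1) (lin_sys_phase _ _ H2)
              Hsys W t) as [Ex Ey].
  destruct (Hb (S t0)) as (A1 & A2 & A3 & A4). destruct (Hb (S t)) as (B1 & B2 & B3 & B4).
  set (dl := eps / (2 * M)) in *.
  set (w0 := Derive xi t0 / lam) in *.
  assert (Hw0 : Rabs w0 <= dl * / lam).
  { unfold w0, Rdiv. rewrite Rabs_mult, (Rabs_pos_eq (/ lam)) by lra.
    apply Rmult_le_compat_r; lra. }
  assert (Hcoef : forall z z', Rabs z <= B -> Rabs z' <= B ->
            Rabs (xi t0 * z - w0 * z') <= dl * (1 + / lam) * B).
  { intros z z' Hz Hz'. eapply Rle_trans; [apply Rabs_triang|].
    rewrite Rabs_Ropp, !Rabs_mult.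
    assert (Rabs (xi t0) * Rabs z <= dl * B) by (apply Rmult_le_compat; try apply Rabs_pos; lra).
    assert (Rabs w0 * Rabs z' <= dl * / lam * B) by (apply Rmult_le_compat; try apply Rabs_pos; lra).
    lra. }
  set (u1 := xi t0 * y2 (S t0) - w0 * x2 (S t0)) in *.
  set (u2 := x1 (S t0) * w0 - y1 (S t0) * xi t0) in *.
  assert (Hu1 : Rabs u1 <= dl * (1 + / lam) * B) by (apply Hcoef; assumption).
  assert (Hu2 : Rabs u2 <= dl * (1 + / lam) * B).
  { rewrite <- Rabs_Ropp. replace (- u2) with (xi t0 * y1 (S t0) - w0 * x1 (S t0))
      by (unfold u2; ring). apply Hcoef; assumption. }
  assert (Hout : forall z z', Rabs z <= B -> Rabs z' <= B ->
            Rabs (u1 * z + u2 * z') * (1 + lam) <= eps / 2).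
  { intros z z' Hz Hz'.
    assert (E : eps / 2 = dl * M) by (unfold dl; field; lra).
    rewrite E. unfold M.
    replace (dl * (2 * B ^ 2 * (1 + / lam) * (1 + lam)))
      with ((dl * (1 + / lam) * B * B + dl * (1 + / lam) * B * B) * (1 + lam)) by ring.
    apply Rmult_le_compat_r; [lra|].
    eapply Rle_trans; [apply Rabs_triang|]. rewrite !Rabs_mult.
    apply Rplus_le_compat; apply Rmult_le_compat; auto using Rabs_pos. }
  pose proof (Hout _ _ B1 B3) as Ox. pose proof (Hout _ _ B2 B4) as Oy.
  rewrite <- Ex in Ox. rewrite <- Ey in Oy.
  pose proof (Rabs_pos (xi t)). pose proof (Rabs_pos (Derive xi t / lam)).
  split; [nra|].
  replace (Derive xi t) with (lam * (Derive xi t / lam)) by (field; lra).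
  rewrite Rabs_mult, (Rabs_pos_eq lam) by lra. nra.
Qed.

(** Since [G >= g > 0], the phase reaches every large multiple of [PI], where the solution has size
    [|mu|^k]. Scaling by [eta] puts its data at time 0 within any prescribed [delta]. *)
Lemma hill_unstable x y mu g :
  lin_sys p r x y -> 0 < g -> (forall s, g <= G s) -> 1 < Rabs mu ->
  (forall k, x (INR k * PI) = mu ^ k) -> ~ zero_stable a.
Proof.
  intros H Hg HG Hmu Hxk Hst.
  destruct (Hst 0 1 ltac:(lra)) as (dl & Hdl & Hd).
  set (m := 1 + Rabs (x (S 0)) + Rabs (lam * y (S 0))).
  pose proof (Rabs_pos (x (S 0))). pose proof (Rabs_pos (lam * y (S 0))).
  set (eta := dl / (2 * m)).
  assert (Hm : 0 < m) by (unfold m; lra).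
  assert (Heta : 0 < eta) by (apply Rdiv_lt_0_compat; lra).
  assert (Hem : eta * m = dl / 2) by (unfold eta; field; lra).
  destruct (is_derive_hill_solution a (fun t => eta * x (S t)) (fun t => eta * (lam * y (S t))))
    as [Hsol HD].
  { intros t. destruct (lin_sys_phase _ _ H t) as [Hx _].
    apply (is_derive_scal (fun t => x (S t))), Hx. }
  { intros t. destruct (lin_sys_phase _ _ H t) as [_ Hy].
    apply (is_derive_ext (fun t => eta * lam * y (S t))); [intros v; apply Rmult_assoc|].
    replace (- a t * (eta * x (S t))) with (eta * lam * (- a t / lam * x (S t))) by (field; lra).
    apply (is_derive_scal (fun t => y (S t))), Hy. }
  assert (Hbd : forall t, 0 <= t -> Rabs (eta * x (S t)) < 1).
  { intros t Ht. apply (Hd _ Hsol); [| |exact Ht].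
    - rewrite Rabs_mult, (Rabs_pos_eq eta) by lra. unfold m in Hem. nra.
    - rewrite HD, Rabs_mult, (Rabs_pos_eq eta) by lra. unfold m in Hem. nra. }
  assert (Hgrow : forall t, 0 < t -> S 0 + g * t <= S t).
  { intros t Ht. destruct (mean_value S (fun t => G (S t)) 0 t Ht) as [c [Hc E]].
    - intros; apply S_derive.
    - specialize (HG (S c)). nra. }
  destruct (Pow_x_infinity mu ltac:(lra) (/ eta)) as [N HN].
  destruct (nfloor_ex (Rabs (S 0))) as [n Hn]; [apply Rabs_pos|].
  (* [N] makes [|mu|^k] exceed [/ eta]; [n + 1 > |S 0|] places [k PI] ahead of the starting
     phase. *)
  set (k := (N + n + 1)%nat).
  assert (Hk : S 0 <= INR k * PI).
  { pose proof PI2_3_2. unfold k. rewrite !plus_INR. simpl (INR 1).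
    pose proof (pos_INR N). pose proof (pos_INR n). pose proof (Rle_abs (S 0)). nra. }
  assert (Hreach : exists t, 0 <= t /\ S t = INR k * PI).
  { set (T := 1 + (INR k * PI - S 0) / g).
    assert (HT : 1 <= T).
    { unfold T. assert (0 <= (INR k * PI - S 0) / g) by (apply Rdiv_le_0_compat; lra). lra. }
    destruct (IVT_gen S 0 T (INR k * PI)) as [t [Ht E]].
    - intros t. apply continuity_pt_filterlim, (ex_derive_continuous S). eexists; apply S_derive.
    - pose proof (Hgrow T ltac:(lra)) as HgT.
      assert (g * T = g + (INR k * PI - S 0)) by (unfold T; field; lra).
      rewrite Rmin_left, Rmax_right; lra.
    - rewrite Rmin_left in Ht by lra. exists t. split; [lra|exact E]. }
  destruct Hreach as (t & Ht & E).
  specialize (Hbd t Ht). rewrite E, Hxk, Rabs_mult, (Rabs_pos_eq eta) in Hbd by lra.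
  specialize (HN k ltac:(unfold k; lia)).
  apply Rge_le in HN. apply (Rmult_le_compat_l eta) in HN; [|lra].
  rewrite Rinv_r in HN by lra. lra.
Qed.

End Transfer.


(** * Persistence of the sign of the quarter product *)

Lemma same_sign_of_near a a' : Rabs (a' - a) < Rabs a -> 0 < a' * a.
Proof. unfold Rabs. repeat destruct Rcase_abs; intros; nra. Qed.

(** A nonzero product has four nonzero entries; no sign changes while each entry moves by less than
    the smallest modulus [m]. *)
Lemma quarter_product_persists sg p0 r0 X1 Y1 X2 Y2 K :
  fundamental p0 r0 X1 Y1 X2 Y2 -> 0 < sg * quarter_product X1 Y1 X2 Y2 ->
  exists e, 0 < e /\ forall p r x1 y1 x2 y2,
    fundamental p r x1 y1 x2 y2 ->
    (forall s, 0 <= s <= PI / 2 -> Rabs (p s) <= K /\ Rabs (r s) <= K) ->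
    (forall s, 0 <= s <= PI / 2 -> Rabs (p s - p0 s) <= e /\ Rabs (r s - r0 s) <= e) ->
    0 < sg * quarter_product x1 y1 x2 y2.
Proof.
  intros (H1 & H2 & E1 & E2 & E3 & E4) Hpos. pose proof PI_RGT_0 as HPI.
  assert (Hbd : forall f, (forall t, continuous f t) ->
            exists B, 0 <= B /\ forall s, 0 <= s <= PI / 2 -> Rabs (f s) <= B).
  { intros f Hf.
    destruct (continuity_ab_maj (fun s => Rabs (f s)) 0 (PI / 2)) as [M [HM _]]; [lra| |].
    - intros s _. apply continuity_pt_filterlim.
      apply (continuous_comp f Rabs); [apply Hf|apply continuous_Rabs].
    - exists (Rabs (f M)). split; [apply Rabs_pos|exact HM]. }
  destruct (lin_sys_continuous _ _ _ _ H1) as [C1 C2].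
  destruct (lin_sys_continuous _ _ _ _ H2) as [C3 C4].
  destruct (Hbd _ C1) as (B1 & P1 & b1). destruct (Hbd _ C2) as (B2 & P2 & b2).
  destruct (Hbd _ C3) as (B3 & P3 & b3). destruct (Hbd _ C4) as (B4 & P4 & b4).
  set (B := B1 + B2 + B3 + B4).
  set (Q := B * (1 + 2 * (PI / 2) * exp ((2 * K + 1) * (PI / 2)))).
  assert (HQ : 0 <= Q).
  { apply Rmult_le_pos; [unfold B; lra|]. pose proof (exp_pos ((2 * K + 1) * (PI / 2))). nra. }
  unfold quarter_product in *.
  set (a := X1 (PI / 2)) in *. set (b := X2 (PI / 2)) in *.
  set (c := Y1 (PI / 2)) in *. set (d := Y2 (PI / 2)) in *.
  assert (Hnz : a <> 0 /\ b <> 0 /\ c <> 0 /\ d <> 0).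
  { repeat split; intro Z; rewrite Z in Hpos; nra. }
  destruct Hnz as (na & nb & nc & nd).
  apply Rabs_pos_lt in na, nb, nc, nd.
  set (m := Rmin (Rmin (Rabs a) (Rabs b)) (Rmin (Rabs c) (Rabs d))).
  assert (Hm : 0 < m) by (unfold m; repeat apply Rmin_glb_lt; assumption).
  assert (Hma : m <= Rabs a /\ m <= Rabs b /\ m <= Rabs c /\ m <= Rabs d).
  { unfold m, Rmin; repeat destruct Rle_dec; repeat split; lra. }
  destruct Hma as (ma & mb & mc & md).
  exists (m / (Q + 1)). split; [apply Rdiv_lt_0_compat; lra|].
  intros p r x1 y1 x2 y2 (h1 & h2 & e1 & e2 & e3 & e4) HK He.
  assert (Hlt : m / (Q + 1) * Q < m).
  { assert (0 < m / (Q + 1)) by (apply Rdiv_lt_0_compat; lra).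
    replace m with (m / (Q + 1) * (Q + 1)) at 2 by (field; lra). nra. }
  assert (Heps : 0 <= m / (Q + 1)) by (apply Rdiv_le_0_compat; lra).
  destruct (lin_sys_perturb p r x1 y1 p0 r0 X1 Y1 K B (PI / 2) (m / (Q + 1)) h1 H1)
    with (s := PI / 2) as [D1 D2]; try assumption; try lra.
  { unfold B; lra. }
  { intros s Hs. specialize (b1 s Hs). specialize (b2 s Hs). unfold B. lra. }
  destruct (lin_sys_perturb p r x2 y2 p0 r0 X2 Y2 K B (PI / 2) (m / (Q + 1)) h2 H2)
    with (s := PI / 2) as [D3 D4]; try assumption; try lra.
  { unfold B; lra. }
  { intros s Hs. specialize (b3 s Hs). specialize (b4 s Hs). unfold B. lra. }
  fold Q a b c d in D1, D2, D3, D4.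
  set (a' := x1 (PI / 2)) in *. set (b' := x2 (PI / 2)) in *.
  set (c' := y1 (PI / 2)) in *. set (d' := y2 (PI / 2)) in *.
  assert (Sa : 0 < a' * a) by (apply same_sign_of_near; lra).
  assert (Sb : 0 < b' * b) by (apply same_sign_of_near; lra).
  assert (Sc : 0 < c' * c) by (apply same_sign_of_near; lra).
  assert (Sd : 0 < d' * d) by (apply same_sign_of_near; lra).
  (* Multiplying all positive quantities leaves the new product times a square, which avoids a case
     distinction on the signs of the entries. *)
  assert (Hall : 0 < (sg * (a * b * c * d)) * ((a' * a) * (b' * b) * (c' * c) * (d' * d)))
    by (apply Rmult_lt_0_compat; [assumption|];
        apply Rmult_lt_0_compat; [apply Rmult_lt_0_compat; [apply Rmult_lt_0_compat|]|]; assumption).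
  replace ((sg * (a * b * c * d)) * ((a' * a) * (b' * b) * (c' * c) * (d' * d)))
    with (sg * (a' * b' * c' * d') * (a * b * c * d) ^ 2) in Hall by ring.
  pose proof (pow2_ge_0 (a * b * c * d)). nra.
Qed.

(** * The Hill equation in the phase variable *)

(** [hill_p] and [hill_r] are dictated by [p_G] and [r_G] when [a = c + mu Theta^2] and
    [Theta^2 = L sin^2]. *)
Definition hill_p (al be lam L s : R) : R := lam / phase_speed al be L s.
Definition hill_r (al be c mu lam L s : R) : R :=
  - (c + mu * L * sin s ^ 2) / (lam * phase_speed al be L s).

Lemma sin_sqr_bound s : 0 <= sin s ^ 2 <= 1.
Proof. pose proof (SIN_bound s). nra. Qed.

Lemma phase_speed_ge al be L s :
  0 < al -> 0 < be -> 0 < L -> sqrt al <= phase_speed al be L s /\ 0 < sqrt al.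
Proof.
  intros Hal Hbe HL. split; [|apply sqrt_lt_R0, Hal].
  apply sqrt_le_1_alt. pose proof (sin_sqr_bound s).
  assert (0 <= be * L * (1 + sin s ^ 2)) by (apply Rmult_le_pos; [apply Rmult_le_pos|]; lra).
  lra.
Qed.

Lemma phase_speed_derivable al be L s :
  0 < al -> 0 < be -> 0 < L -> ex_derive (phase_speed al be L) s.
Proof.
  intros Hal Hbe HL. unfold phase_speed. auto_derive.
  pose proof (sin_sqr_bound s).
  assert (0 <= be * L * (1 + sin s ^ 2)) by (apply Rmult_le_pos; [apply Rmult_le_pos|]; lra).
  simpl in *. lra.
Qed.

Lemma hill_fundamental_exists al be c mu lam L :
  0 < al -> 0 < be -> 0 < c -> 0 < mu -> 0 < lam -> 0 < L ->
  exists x1 y1 x2 y2,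
    fundamental (hill_p al be lam L) (hill_r al be c mu lam L) x1 y1 x2 y2.
Proof.
  intros Hal Hbe Hc Hmu Hlam HL.
  assert (Hi : forall s, 0 < / phase_speed al be L s <= / sqrt al).
  { intros s. destruct (phase_speed_ge al be L s Hal Hbe HL). split.
    - apply Rinv_0_lt_compat; lra. - apply Rinv_le_contravar; lra. }
  assert (Hil : 0 < / lam) by (apply Rinv_0_lt_compat, Hlam).
  assert (HmuL : 0 < mu * L) by (apply Rmult_lt_0_compat; assumption).
  apply (fundamental_exists _ _ (lam * / sqrt al + (c + mu * L) * (/ lam * / sqrt al))).
  - intros s. apply (ex_derive_continuous (V := R_NormedModule)).
    pose proof (phase_speed_derivable al be L s Hal Hbe HL).
    destruct (phase_speed_ge al be L s Hal Hbe HL).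
    unfold hill_p. auto_derive. repeat split; [assumption|lra].
  - intros s. apply (ex_derive_continuous (V := R_NormedModule)).
    pose proof (phase_speed_derivable al be L s Hal Hbe HL).
    destruct (phase_speed_ge al be L s Hal Hbe HL).
    unfold hill_r. auto_derive. repeat split; [assumption|].
    apply Rmult_integral_contrapositive; split; lra.
  - intros s. specialize (Hi s). unfold hill_p, Rdiv. rewrite Rabs_pos_eq by nra.
    assert (0 <= (c + mu * L) * (/ lam * / sqrt al))
      by (apply Rmult_le_pos; [lra|]; apply Rmult_le_pos; lra).
    assert (lam * / phase_speed al be L s <= lam * / sqrt al) by (apply Rmult_le_compat_l; lra).
    lra.
  - intros s. specialize (Hi s). pose proof (sin_sqr_bound s).
    unfold hill_r, Rdiv. rewrite Rinv_mult, Rabs_mult, Rabs_Ropp.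
    assert (0 <= / lam * / phase_speed al be L s) by (apply Rmult_le_pos; lra).
    assert (0 <= mu * L * sin s ^ 2 <= mu * L) by nra.
    rewrite 2!Rabs_pos_eq by lra.
    assert (0 <= lam * / sqrt al) by (apply Rmult_le_pos; lra).
    assert ((c + mu * L * sin s ^ 2) * (/ lam * / phase_speed al be L s)
            <= (c + mu * L) * (/ lam * / sqrt al)).
    { apply Rmult_le_compat; try lra. apply Rmult_le_compat_l; lra. }
    lra.
Qed.

Lemma phase_speed_even al be L s : phase_speed al be L (- s) = phase_speed al be L s.
Proof. unfold phase_speed. rewrite sin_neg. do 2 f_equal. field. Qed.

Lemma phase_speed_periodic al be L s : phase_speed al be L (s + PI) = phase_speed al be L s.
Proof. unfold phase_speed. rewrite neg_sin. do 2 f_equal. field. Qed.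

Definition hill_sign (sg al be c mu lam L : R) : Prop :=
  forall x1 y1 x2 y2,
    fundamental (hill_p al be lam L) (hill_r al be c mu lam L) x1 y1 x2 y2 ->
    0 < sg * quarter_product x1 y1 x2 y2.

Lemma hill_sign_alternative al be c mu lam L S a :
  0 < al -> 0 < be -> 0 < c -> 0 < mu -> 0 < lam -> 0 < L ->
  (forall t, is_derive S t (phase_speed al be L (S t))) ->
  (forall t, a t = c + mu * (L * sin (S t) ^ 2)) ->
  (hill_sign (-1) al be c mu lam L -> zero_stable a) /\
  (hill_sign 1 al be c mu lam L -> ~ zero_stable a).
Proof.
  intros Hal Hbe Hc Hmu Hlam HL HS Ha.
  destruct (hill_fundamental_exists al be c mu lam L) as (x1 & y1 & x2 & y2 & HF);
    try assumption.
  assert (HG : forall s, sqrt al <= phase_speed al be L s /\ 0 < sqrt al)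
    by (intros; apply phase_speed_ge; assumption).
  assert (HpG : forall s, hill_p al be lam L s * phase_speed al be L s = lam).
  { intros s. unfold hill_p. specialize (HG s). field. lra. }
  assert (HrG : forall t, hill_r al be c mu lam L (S t) * phase_speed al be L (S t) * lam = - a t).
  { intros t. unfold hill_r. specialize (HG (S t)). rewrite Ha. field. lra. }
  assert (pe : forall s, hill_p al be lam L (- s) = hill_p al be lam L s)
    by (intros; unfold hill_p; rewrite phase_speed_even; reflexivity).
  assert (re : forall s, hill_r al be c mu lam L (- s) = hill_r al be c mu lam L s).
  { intros; unfold hill_r. rewrite phase_speed_even, sin_neg.
    replace ((- sin s) ^ 2) with (sin s ^ 2) by ring. reflexivity. }
  assert (pp : forall s, hill_p al be lam L (s + PI) = hill_p al be lam L s)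
    by (intros; unfold hill_p; rewrite phase_speed_periodic; reflexivity).
  assert (rp : forall s, hill_r al be c mu lam L (s + PI) = hill_r al be c mu lam L s).
  { intros; unfold hill_r. rewrite phase_speed_periodic, neg_sin.
    replace ((- sin s) ^ 2) with (sin s ^ 2) by ring. reflexivity. }
  split; intros Hsg; specialize (Hsg _ _ _ _ HF); unfold quarter_product in Hsg.
  - destruct (floquet_bounded _ _ _ _ _ _ pe re pp rp HF) as (B & HB & Hb); [lra|].
    exact (hill_stable _ _ _ S a lam Hlam HS HpG HrG _ _ _ _ B HF HB Hb).
  - destruct (floquet_unstable _ _ _ _ _ _ pe re pp rp HF) as (x & y & mm & Hxy & Hm & Hk);
      [lra|].
    exact (hill_unstable _ _ _ S a lam Hlam HS HpG HrG x y mm (sqrt al) Hxy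
             (proj2 (HG 0)) (fun s => proj1 (HG s)) Hm Hk).
Qed.

(** * Large amplitudes *)

(** The threshold [1 / 2] is the minimum of [(1 + sin^2) / 2]. *)
Lemma inv_sqrt_lipschitz u v :
  1 / 2 <= u -> 1 / 2 <= v -> Rabs (/ sqrt u - / sqrt v) <= 2 * Rabs (u - v).
Proof.
  intros Hu Hv.
  assert (Hs : forall w, 1 / 2 <= w -> 7 / 10 <= sqrt w /\ sqrt w * sqrt w = w).
  { intros w Hw. pose proof (sqrt_sqrt w ltac:(lra)). pose proof (sqrt_pos w).
    split; [nra|lra]. }
  destruct (Hs u Hu) as [A1 A2]. destruct (Hs v Hv) as [B1 B2].
  set (x := sqrt u) in *. set (y := sqrt v) in *. clearbody x y. subst u v.
  replace (/ x - / y) with ((x * x - y * y) * - / (x * y * (x + y))) by (field; lra).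
  rewrite Rabs_mult, Rmult_comm. apply Rmult_le_compat_r; [apply Rabs_pos|].
  assert (49 / 100 <= x * y) by nra.
  assert (1 / 2 <= x * y * (x + y)) by nra.
  rewrite Rabs_Ropp, Rabs_pos_eq by (left; apply Rinv_0_lt_compat; lra).
  replace 2 with (/ (1 / 2)) by field. apply Rinv_le_contravar; lra.
Qed.

(** The phase speed is [sqrt (be L)] times a factor converging to [lemn_speed]. With
    [lam = sqrt (be L)] the coefficients are within [C / L] of [lame_p] and [lame_r (mu / be)]. *)
Lemma hill_sign_large sg al be c mu :
  0 < al -> 0 < be -> 0 < c -> 0 < mu -> lame_sign sg (mu / be) ->
  exists L0, forall L, L0 < L -> 0 < L -> hill_sign sg al be c mu (sqrt (be * L)) L.
Proof.
  intros Hal Hbe Hc Hmu Hsg.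
  set (gam := mu / be) in *. set (om := al / be). set (cb := c / be).
  assert (Hgam : 0 < gam) by (apply Rdiv_lt_0_compat; assumption).
  assert (Hom : 0 < om) by (apply Rdiv_lt_0_compat; assumption).
  assert (Hcb : 0 < cb) by (apply Rdiv_lt_0_compat; assumption).
  destruct (lame_fundamental_exists gam) as (X1 & Y1 & X2 & Y2 & HF).
  destruct (quarter_product_persists sg _ _ _ _ _ _ (2 + 2 * (cb + gam)) HF (Hsg _ _ _ _ HF))
    as (e & He & Hper).
  set (C := 2 * om + 2 * cb + 2 * gam * om).
  assert (Hgo : 0 < gam * om) by (apply Rmult_lt_0_compat; assumption).
  assert (HC : 0 < C) by (unfold C; lra).
  (* The 1 keeps [om / L] and [cb / L] below [om] and [cb]; [C / e] brings the error [C / L] below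
     [e]. *)
  exists (1 + C / e). intros L HL HL0 x1 y1 x2 y2 Hf.
  assert (HCe : 0 < C / e) by (apply Rdiv_lt_0_compat; assumption).
  assert (Heps : C / L <= e).
  { apply Rmult_le_reg_r with L; [assumption|].
    replace (C / L * L) with C by (field; lra).
    replace C with (C / e * e) by (field; lra). nra. }
  assert (HbL : 0 < be * L) by (apply Rmult_lt_0_compat; assumption).
  set (q := fun s => / sqrt (om / L + (1 + sin s ^ 2) / 2)).
  assert (HoL : 0 < om / L <= om).
  { split; [apply Rdiv_lt_0_compat; lra|]. apply Rmult_le_reg_r with L; [assumption|].
    replace (om / L * L) with om by (field; lra). nra. }
  assert (HcL : 0 < cb / L <= cb).
  { split; [apply Rdiv_lt_0_compat; lra|]. apply Rmult_le_reg_r with L; [assumption|].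
    replace (cb / L * L) with cb by (field; lra). nra. }
  assert (Hspeed : forall s, phase_speed al be L s
            = sqrt (be * L) * sqrt (om / L + (1 + sin s ^ 2) / 2)).
  { intros s. unfold phase_speed. rewrite <- sqrt_mult_alt by lra.
    f_equal. unfold om. field. lra. }
  assert (HsL : 0 < sqrt (be * L)) by (apply sqrt_lt_R0, HbL).
  assert (Hsq : forall s, 7 / 10 <= sqrt (om / L + (1 + sin s ^ 2) / 2)).
  { intros s. pose proof (sin_sqr_bound s).
    pose proof (sqrt_sqrt (om / L + (1 + sin s ^ 2) / 2) ltac:(lra)).
    pose proof (sqrt_pos (om / L + (1 + sin s ^ 2) / 2)). nra. }
  assert (Hp : forall s, hill_p al be (sqrt (be * L)) L s = q s).
  { intros s. unfold hill_p, q. rewrite Hspeed. specialize (Hsq s). field. lra. }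
  assert (Hr : forall s, hill_r al be c mu (sqrt (be * L)) L s
                         = - (cb / L + gam * sin s ^ 2) * q s).
  { intros s. unfold hill_r, q. rewrite Hspeed. specialize (Hsq s).
    rewrite <- Rmult_assoc, sqrt_sqrt by lra. unfold cb, gam. field. lra. }
  assert (Hq : forall s, 0 < q s <= 2).
  { intros s. specialize (Hsq s). unfold q. split; [apply Rinv_0_lt_compat; lra|].
    apply Rle_trans with (/ (7 / 10)); [apply Rinv_le_contravar; lra|lra]. }
  assert (Hdq : forall s, Rabs (q s - lame_p s) <= 2 * (om / L)).
  { intros s. pose proof (sin_sqr_bound s). unfold q, lame_p, lemn_speed.
    eapply Rle_trans; [apply inv_sqrt_lipschitz; lra|].
    replace (om / L + (1 + sin s ^ 2) / 2 - (1 + sin s ^ 2) / 2) with (om / L) by ring.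
    rewrite Rabs_pos_eq by lra. lra. }
  apply (Hper _ _ _ _ _ _ Hf).
  - intros s _. rewrite Hp, Hr. specialize (Hq s). pose proof (sin_sqr_bound s).
    rewrite Rabs_mult, Rabs_Ropp, (Rabs_pos_eq (q s)) by lra.
    assert (0 <= gam * sin s ^ 2 <= gam) by nra.
    rewrite Rabs_pos_eq by lra. split; [lra|]. nra.
  - intros s _. rewrite Hp, Hr. specialize (Hq s). specialize (Hdq s).
    pose proof (sin_sqr_bound s).
    assert (EC : C / L = 2 * (om / L) + 2 * (cb / L) + gam * (2 * (om / L)))
      by (unfold C; field; lra).
    assert (0 < gam * (2 * (om / L))) by (apply Rmult_lt_0_compat; lra).
    split; [lra|].
    replace (lame_r gam s) with (- gam * sin s ^ 2 * lame_p s)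
      by (unfold lame_r, lame_p, Rdiv; ring).
    replace (- (cb / L + gam * sin s ^ 2) * q s - - gam * sin s ^ 2 * lame_p s)
      with (- (cb / L * q s) + - (gam * sin s ^ 2) * (q s - lame_p s)) by ring.
    eapply Rle_trans; [apply Rabs_triang|].
    rewrite Rabs_mult, !Rabs_Ropp.
    assert (0 <= gam * sin s ^ 2 <= gam) by nra.
    assert (0 <= cb / L * q s <= 2 * (cb / L)).
    { split; [apply Rmult_le_pos; lra|].
      rewrite (Rmult_comm 2). apply Rmult_le_compat_l; lra. }
    rewrite (Rabs_pos_eq (cb / L * q s)), (Rabs_pos_eq (gam * sin s ^ 2)) by lra.
    assert (gam * sin s ^ 2 * Rabs (q s - lame_p s) <= gam * (2 * (om / L)))
      by (apply Rmult_le_compat; try apply Rabs_pos; lra).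
    lra.
Qed.

(** * Small amplitudes *)

Lemma inv_sqrt_expansion u :
  0 <= u -> 1 - u / 2 <= / sqrt (1 + u) <= 1 - u / 2 + u ^ 2 /\ / sqrt (1 + u) <= 1.
Proof.
  intros Hu. pose proof (sqrt_sqrt (1 + u) ltac:(lra)) as E.
  pose proof (sqrt_pos (1 + u)) as P.
  set (z := sqrt (1 + u)) in *. clearbody z.
  assert (Hz : 1 <= z) by nra.
  (* With [sqrt (1 + u) = 1 + t] and [u = t (t + 2)] the bounds become polynomial in [t >= 0]. *)
  set (t := z - 1). assert (Ht : 0 <= t) by (unfold t; lra).
  assert (Hu' : u = t * (t + 2)) by (unfold t; nra).
  replace z with (1 + t) by (unfold t; ring). clearbody t. subst u. clear E P Hz.
  pose proof (Rmult_le_pos t t Ht Ht) as T2. pose proof (Rmult_le_pos _ _ T2 Ht) as T3.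
  pose proof (Rmult_le_pos _ _ T3 Ht) as T4. pose proof (Rmult_le_pos _ _ T4 Ht) as T5.
  split; [split|].
  - apply Rmult_le_reg_r with (1 + t); [lra|]. rewrite Rinv_l by lra. nra.
  - apply Rmult_le_reg_r with (1 + t); [lra|]. rewrite Rinv_l by lra. nra.
  - apply Rmult_le_reg_r with (1 + t); [lra|]. rewrite Rinv_l by lra. lra.
Qed.

Lemma trig_fundamental kap :
  fundamental (fun _ => kap) (fun _ => - kap)
    (fun s => cos (kap * s)) (fun s => - sin (kap * s))
    (fun s => sin (kap * s)) (fun s => cos (kap * s)).
Proof.
  split; [|split].
  - intros s. split; derive_solve; ring.
  - intros s. split; derive_solve; ring.
  - rewrite Rmult_0_r, sin_0, cos_0. repeat split; ring.
Qed.

(* First-order drift of the slow variables at a resonance [sin (kap PI) = 0];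
   [sg = 1] weights the [sin^2]-term by [cos^2 (kap s)], [sg = -1] by
   [sin^2 (kap s)]. *)
Definition drift (b e kap sg s : R) : R :=
  b / 4 * (3 / 2 * s - sin (2 * s) / 4)
  - e / 4 * (s - sin (2 * s) / 2
             + sg * (sin (2 * kap * s) / (2 * kap)
                     - (sin (2 * (kap + 1) * s) / (2 * (kap + 1))
                        + sin (2 * (kap - 1) * s) / (2 * (kap - 1))) / 2)).

Lemma drift_derive b e kap sg s :
  1 < kap ->
  is_derive (drift b e kap sg) s
    (b * (1 + sin s ^ 2) / 4 - e * sin s ^ 2 * ((1 + sg * cos (2 * (kap * s))) / 2)).
Proof.
  intros Hk. unfold drift. auto_derive; [repeat split; lra|].
  replace (2 * kap * s) with (2 * (kap * s)) by ring.
  replace (2 * (kap + 1) * s) with (2 * (kap * s) + 2 * s) by ring.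
  replace (2 * (kap - 1) * s) with (2 * (kap * s) - 2 * s) by ring.
  rewrite cos_plus, cos_minus.
  replace (sin s ^ 2) with ((1 - cos (2 * s)) / 2) by (rewrite cos_2a_sin; field).
  field. lra.
Qed.

(** At [PI / 2] every oscillating term is a sine at [PI], [kap PI] or [kap PI +- PI], so all vanish
    at a resonance. The end value therefore does not depend on [sg], and both slow components drift
    alike. *)
Lemma drift_end b e kap sg :
  1 < kap -> sin (kap * PI) = 0 ->
  drift b e kap sg (PI / 2) = PI / 16 * (3 * b - 2 * e) /\ drift b e kap sg 0 = 0.
Proof.
  intros Hk H. unfold drift. split.
  - replace (2 * (PI / 2)) with PI by field.
    replace (2 * kap * (PI / 2)) with (kap * PI) by field.
    replace (2 * (kap + 1) * (PI / 2)) with (kap * PI + PI) by field.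
    replace (2 * (kap - 1) * (PI / 2)) with (kap * PI - PI) by field.
    rewrite sin_plus, sin_minus, sin_PI, H. field. lra.
  - rewrite !Rmult_0_r, sin_0. field. lra.
Qed.

Section SmallAmplitude.

Variables al be c mu : R.
Hypothesis al_pos : 0 < al.
Hypothesis be_pos : 0 < be.
Hypothesis c_pos : 0 < c.
Hypothesis mu_pos : 0 < mu.

Let b := be / al.
Let e := mu / c.
Let kap := sqrt (c / al).
Let b_pos : 0 < b := Rdiv_lt_0_compat _ _ be_pos al_pos.
Let e_pos : 0 < e := Rdiv_lt_0_compat _ _ mu_pos c_pos.
Let kap_pos : 0 < kap := sqrt_lt_R0 _ (Rdiv_lt_0_compat _ _ c_pos al_pos).

Let u (L s : R) := b * L * ((1 + sin s ^ 2) / 2).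
Let q (L s : R) := / sqrt (1 + u L s).

Lemma small_u L s : 0 < L -> 0 <= u L s <= b * L.
Proof.
  intros HL. unfold u. pose proof (sin_sqr_bound s).
  assert (0 < b * L) by (apply Rmult_lt_0_compat; assumption). nra.
Qed.

(** The choice [lam = sqrt c] balances the limits for [L -> 0]: they are [kap] and [- kap], a pure
    rotation. *)
Lemma small_coefs L s :
  0 < L ->
  hill_p al be (sqrt c) L s = kap * q L s /\
  hill_r al be c mu (sqrt c) L s = - (kap * (1 + e * L * sin s ^ 2) * q L s).
Proof.
  intros HL. pose proof (small_u L s HL) as Hu.
  assert (Hsp : phase_speed al be L s = sqrt al * sqrt (1 + u L s)).
  { unfold phase_speed. rewrite <- sqrt_mult_alt by lra. f_equal.
    unfold u, b. field. lra. }
  assert (Hka : kap = sqrt c / sqrt al) by (apply sqrt_div; lra).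
  assert (0 < sqrt al) by (apply sqrt_lt_R0; lra).
  assert (0 < sqrt c) by (apply sqrt_lt_R0; lra).
  assert (0 < sqrt (1 + u L s)) by (apply sqrt_lt_R0; lra).
  assert (Hcc : sqrt c * sqrt c = c) by (apply sqrt_sqrt; lra).
  unfold hill_p, hill_r, q. rewrite Hsp, Hka. split; [field; lra|].
  unfold e. set (sc := sqrt c) in *. clearbody sc.
  transitivity (- (sc * sc * (1 + mu / c * L * sin s ^ 2)) / (sc * (sqrt al * sqrt (1 + u L s)))).
  - rewrite Hcc. field. lra.
  - field. lra.
Qed.

Lemma small_q L s :
  0 < L -> 0 < q L s <= 1 /\ 0 <= 1 - q L s <= b * L /\
           Rabs (1 - q L s - u L s / 2) <= (b * L) ^ 2.
Proof.
  intros HL. pose proof (small_u L s HL) as Hu.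
  destruct (inv_sqrt_expansion (u L s)) as [[H1 H2] H3]; [lra|].
  unfold q. set (v := u L s) in *. clearbody v.
  assert (0 < / sqrt (1 + v)) by (apply Rinv_0_lt_compat, sqrt_lt_R0; lra).
  repeat split; try lra.
  apply Rabs_le. assert (v ^ 2 <= (b * L) ^ 2) by (apply pow_incr; lra). split; lra.
Qed.

Lemma small_bounds L s :
  0 < L <= 1 ->
  (Rabs (hill_p al be (sqrt c) L s) <= kap * (1 + e) /\
   Rabs (hill_r al be c mu (sqrt c) L s) <= kap * (1 + e)) /\
  (Rabs (hill_p al be (sqrt c) L s - kap) <= L * (kap * (b + e)) /\
   Rabs (hill_r al be c mu (sqrt c) L s - - kap) <= L * (kap * (b + e))).
Proof.
  intros HL. destruct (small_coefs L s) as [-> ->]; [lra|].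
  destruct (small_q L s) as (Hq & Hq1 & _); [lra|]. pose proof (sin_sqr_bound s).
  set (z := q L s) in *. set (v := sin s ^ 2) in *. clearbody z v.
  assert (HeL : 0 < e * L <= e) by nra.
  assert (Hev : 0 <= e * L * v <= e * L) by nra.
  assert (Hevz : 0 <= e * L * v * z <= e * L) by nra.
  replace (L * (kap * (b + e))) with (kap * (b * L + e * L)) by ring.
  replace (kap * z - kap) with (- (kap * (1 - z))) by ring.
  replace (- (kap * (1 + e * L * v) * z) - - kap)
    with (kap * (1 - z - e * L * v * z)) by ring.
  rewrite 2!Rabs_Ropp. rewrite Rmult_assoc.
  rewrite !Rabs_mult, (Rabs_pos_eq kap) by lra.
  repeat split; apply Rmult_le_compat_l; try lra.
  - rewrite Rabs_pos_eq; lra.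
  - rewrite <- Rabs_mult. rewrite Rabs_pos_eq; nra.
  - rewrite Rabs_pos_eq; lra.
  - apply Rabs_le; lra.
Qed.

Lemma hill_sign_small_nonresonant :
  sin (kap * PI) <> 0 ->
  exists L0, 0 < L0 /\ forall L, 0 < L < L0 -> hill_sign (-1) al be c mu (sqrt c) L.
Proof.
  intros Hns.
  destruct (quarter_product_persists (-1) _ _ _ _ _ _ (kap * (1 + e)) (trig_fundamental kap))
    as (eps & Heps & Hper).
  { unfold quarter_product.
    replace (kap * PI) with (2 * (kap * (PI / 2))) in Hns by field.
    rewrite sin_2a in Hns.
    set (S := sin (kap * (PI / 2))) in *. set (C := cos (kap * (PI / 2))) in *.
    replace (-1 * (C * S * - S * C)) with ((S * C) ^ 2) by ring.
    apply pow2_gt_0. intro E. apply Hns. rewrite Rmult_assoc, E. ring. }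
  assert (Hk : 0 < kap * (b + e)) by (apply Rmult_lt_0_compat; lra).
  exists (Rmin 1 (eps / (kap * (b + e)))). split.
  { apply Rmin_glb_lt; [lra|]. apply Rdiv_lt_0_compat; assumption. }
  intros L [HL0 HL] x1 y1 x2 y2 HF.
  assert (HL1 : L < 1) by (eapply Rlt_le_trans; [exact HL|apply Rmin_l]).
  assert (HLe : L < eps / (kap * (b + e))) by (eapply Rlt_le_trans; [exact HL|apply Rmin_r]).
  assert (Hle : L * (kap * (b + e)) <= eps).
  { replace eps with (eps / (kap * (b + e)) * (kap * (b + e))) by (field; lra).
    apply Rmult_le_compat_r; lra. }
  apply (Hper _ _ _ _ _ _ HF).
  - intros s _. apply (small_bounds L s). lra.
  - intros s _. destruct (small_bounds L s) as [_ [A1 A2]]; [lra|]. split; lra.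
Qed.

(* In the frame rotating with angle [kap s] the two slow components that vanish
   at [s = 0] drift by [+- L kap drift] up to [O(L^2)]. *)
Lemma hill_sign_small_resonant :
  1 < kap -> e < b -> sin (kap * PI) = 0 ->
  exists L0, 0 < L0 /\ forall L, 0 < L < L0 -> hill_sign (-1) al be c mu (sqrt c) L.
Proof.
  intros Hkap Heb Hres. pose proof PI_RGT_0 as HPI.
  set (K := kap * (1 + e)). set (N := kap * (b + e)).
  assert (HN : 0 < N) by (apply Rmult_lt_0_compat; lra).
  (* The constant of [lin_sys_perturb] with [B = 1]: the solutions stay within [L * C2] of the
     rotation. *)
  set (C2 := N * (1 * (1 + 2 * (PI / 2) * exp ((2 * K + 1) * (PI / 2))))).
  assert (HC2 : 0 < C2).
  { apply Rmult_lt_0_compat; [assumption|]. pose proof (exp_pos ((2 * K + 1) * (PI / 2))). nra. }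
  (* Second-order error of the drift rate: [2 N C2] from putting the rotation in place of the
     solution, the rest from expanding the coefficients in [L]. *)
  set (C3 := 2 * N * C2 + kap * (b ^ 2 + (b ^ 2 + e * b))).
  assert (HC3 : 0 < C3).
  { unfold C3. assert (0 < N * C2) by (apply Rmult_lt_0_compat; assumption).
    assert (0 < kap * (b ^ 2 + (b ^ 2 + e * b))) by (apply Rmult_lt_0_compat; nra). lra. }
  set (eta := kap * (PI / 16 * (3 * b - 2 * e))).
  assert (Heta : 0 < eta) by (apply Rmult_lt_0_compat; [|apply Rmult_lt_0_compat]; lra).
  (* [L < / M] secures [L <= 1], [4 L C2 < 1] and [L C3 PI < eta] at once. *)
  set (M := 1 + 4 * C2 + C3 * PI / eta).
  assert (HM1 : 0 < C3 * PI / eta)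
    by (apply Rdiv_lt_0_compat; [apply Rmult_lt_0_compat|]; assumption).
  assert (HM : 1 <= M) by (unfold M; lra).
  exists (/ M). split; [apply Rinv_0_lt_compat; lra|].
  intros L [HL0 HL] x1 y1 x2 y2 HF.
  assert (HLM : L * M < 1).
  { apply Rmult_lt_compat_r with (r := M) in HL; [|lra]. rewrite Rinv_l in HL; lra. }
  assert (HL1 : L <= 1) by nra.
  assert (HLC2 : 4 * (L * C2) < 1).
  { unfold M in HLM. assert (0 < L * (C3 * PI / eta)) by (apply Rmult_lt_0_compat; lra). nra. }
  assert (HLC3 : L * C3 * PI < eta).
  { unfold M in HLM. assert (0 < L * C2) by (apply Rmult_lt_0_compat; lra).
    assert (HH : L * (C3 * PI / eta) < 1) by nra.
    apply Rmult_lt_compat_r with (r := eta) in HH; [|assumption].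
    replace (L * (C3 * PI / eta) * eta) with (L * C3 * PI) in HH by (field; lra). lra. }
  set (p := hill_p al be (sqrt c) L) in *. set (r := hill_r al be c mu (sqrt c) L) in *.
  assert (Hb : forall s, (Rabs (p s) <= K /\ Rabs (r s) <= K) /\
                         (Rabs (p s - kap) <= L * N /\ Rabs (r s - - kap) <= L * N))
    by (intros; apply small_bounds; lra).
  destruct HF as (H1 & H2 & E1 & E2 & E3 & E4).
  pose proof (trig_fundamental kap) as (T1 & T2 & T3 & T4 & T5 & T6). cbv beta in T3, T4, T5, T6.
  assert (Hsc : forall s, Rabs (sin s) <= 1 /\ Rabs (cos s) <= 1).
  { intros s. pose proof (SIN_bound s). pose proof (COS_bound s). split; apply Rabs_le; lra. }
  assert (HLN : 0 <= L * N) by (apply Rmult_le_pos; lra).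
  assert (Hx1 : forall s, 0 <= s <= PI / 2 ->
            Rabs (x1 s - cos (kap * s)) <= L * C2 /\ Rabs (y1 s - - sin (kap * s)) <= L * C2).
  { intros s Hs. unfold C2. rewrite <- Rmult_assoc.
    apply (lin_sys_perturb p r x1 y1 _ _ _ _ K 1 (PI / 2) (L * N) H1 T1); try assumption.
    - rewrite E1, T3; reflexivity. - rewrite E2, T4; reflexivity. - lra.
    - intros; apply Hb. - intros. rewrite Rabs_Ropp. split; apply Hsc. - intros; apply Hb. }
  assert (Hx2 : forall s, 0 <= s <= PI / 2 ->
            Rabs (x2 s - sin (kap * s)) <= L * C2 /\ Rabs (y2 s - cos (kap * s)) <= L * C2).
  { intros s Hs. unfold C2. rewrite <- Rmult_assoc.
    apply (lin_sys_perturb p r x2 y2 _ _ _ _ K 1 (PI / 2) (L * N) H2 T2); try assumption.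
    - rewrite E3, T5; reflexivity. - rewrite E4, T6; reflexivity. - lra.
    - intros; apply Hb. - intros. split; apply Hsc. - intros; apply Hb. }
  (* [A], [B] are [sin (kap s)], [cos (kap s)] up to sign, in either order. *)
  assert (Hdrift : forall s x y A B sg, 0 <= s <= PI / 2 ->
     A ^ 2 + B ^ 2 = 1 -> B ^ 2 = (1 + sg * cos (2 * (kap * s))) / 2 ->
     Rabs (x - B) <= L * C2 -> Rabs (y - - A) <= L * C2 ->
     Rabs ((p s - kap) * y * A + (r s + kap) * x * B
           - L * (kap * (b * (1 + sin s ^ 2) / 4
                         - e * sin s ^ 2 * ((1 + sg * cos (2 * (kap * s))) / 2)))) <= L ^ 2 * C3).
  { intros s x y A B sg Hs HAB <- Hx Hy.
    destruct (Hb s) as [_ [Hp Hr]]. replace (r s - - kap) with (r s + kap) in Hr by ring.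
    destruct (small_q L s HL0) as (Hq & Hq1 & Hq2).
    destruct (small_coefs L s HL0) as [Ep Er]. fold (p s) in Ep. fold (r s) in Er.
    pose proof (sin_sqr_bound s) as Hsin.
    assert (HA1 : Rabs A <= 1) by (apply Rabs_le; nra).
    assert (HB1 : Rabs B <= 1) by (apply Rabs_le; nra).
    set (v := sin s ^ 2) in *. set (z := q L s) in *.
    set (P := p s - kap) in *. set (R := r s + kap) in *.
    replace (P * y * A + R * x * B - L * (kap * (b * (1 + v) / 4 - e * v * B ^ 2)))
      with ((P * A * (y - - A) + R * B * (x - B))
            + (- P * A ^ 2 + R * B ^ 2 - L * (kap * (b * (1 + v) / 4 - e * v * B ^ 2)))) by ring.
    assert (Err1 : Rabs (P * A * (y - - A) + R * B * (x - B)) <= L ^ 2 * (2 * N * C2)).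
    { eapply Rle_trans; [apply Rabs_triang|]. rewrite !Rabs_mult.
      assert (Rabs P * Rabs A <= L * N * 1) by (apply Rmult_le_compat; auto using Rabs_pos).
      assert (Rabs R * Rabs B <= L * N * 1) by (apply Rmult_le_compat; auto using Rabs_pos).
      assert (Rabs P * Rabs A * Rabs (y - - A) <= L * N * 1 * (L * C2))
        by (apply Rmult_le_compat; auto using Rabs_pos; apply Rmult_le_pos; apply Rabs_pos).
      assert (Rabs R * Rabs B * Rabs (x - B) <= L * N * 1 * (L * C2))
        by (apply Rmult_le_compat; auto using Rabs_pos; apply Rmult_le_pos; apply Rabs_pos).
      lra. }
    assert (Err2 : Rabs (- P * A ^ 2 + R * B ^ 2 - L * (kap * (b * (1 + v) / 4 - e * v * B ^ 2)))
                   <= L ^ 2 * (kap * (b ^ 2 + (b ^ 2 + e * b)))).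
    { assert (EP : - P = kap * (1 - z)) by (unfold P; rewrite Ep; ring).
      assert (ER : R = kap * ((1 - z) - e * L * v + e * L * v * (1 - z)))
        by (unfold R; rewrite Er; ring).
      rewrite EP, ER.
      replace (kap * (1 - z) * A ^ 2
               + kap * ((1 - z) - e * L * v + e * L * v * (1 - z)) * B ^ 2
               - L * (kap * (b * (1 + v) / 4 - e * v * B ^ 2)))
        with (kap * ((1 - z) * (A ^ 2 + B ^ 2) - L * (b * (1 + v) / 4)
                     + e * L * v * (1 - z) * B ^ 2)) by ring.
      rewrite HAB.
      replace ((1 - z) * 1 - L * (b * (1 + v) / 4)) with (1 - z - u L s / 2)
        by (unfold u; fold v; field).
      rewrite Rabs_mult, (Rabs_pos_eq kap) by lra.
      replace (L ^ 2 * (kap * (b ^ 2 + (b ^ 2 + e * b))))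
        with (kap * (L ^ 2 * (b ^ 2 + (b ^ 2 + e * b)))) by ring.
      apply Rmult_le_compat_l; [lra|].
      eapply Rle_trans; [apply Rabs_triang|].
      assert (HB2 : 0 <= B ^ 2 <= 1) by nra.
      assert (HeL : 0 < e * L) by (apply Rmult_lt_0_compat; assumption).
      assert (0 <= e * L * v <= e * L) by nra.
      assert (0 <= e * L * v * (1 - z) <= e * L * (b * L))
        by (split; [apply Rmult_le_pos; lra | apply Rmult_le_compat; lra]).
      assert (0 <= e * L * v * (1 - z) * B ^ 2 <= e * L * (b * L) * 1)
        by (split; [apply Rmult_le_pos; lra | apply Rmult_le_compat; lra]).
      rewrite (Rabs_pos_eq (e * L * v * (1 - z) * B ^ 2)) by lra.
      assert (0 <= (L * b) ^ 2) by apply pow2_ge_0. nra. }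
    eapply Rle_trans; [apply Rabs_triang|]. unfold C3. lra. }
  (* The first-order gain is [L * eta] and the accumulated error at most [L^2 C3 PI / 2], which is
     smaller. *)
  assert (Hend : forall z z' sg,
     z 0 = 0 -> (forall s, is_derive z s (z' s)) ->
     (forall s, 0 <= s <= PI / 2 ->
        Rabs (z' s - L * (kap * (b * (1 + sin s ^ 2) / 4
                         - e * sin s ^ 2 * ((1 + sg * cos (2 * (kap * s))) / 2)))) <= L ^ 2 * C3) ->
     0 < z (PI / 2)).
  { intros z z' sg Hz0 Hz Hz'.
    destruct (mean_value (fun s => z s - L * (kap * drift b e kap sg s))
      (fun s => z' s - L * (kap * (b * (1 + sin s ^ 2) / 4
                         - e * sin s ^ 2 * ((1 + sg * cos (2 * (kap * s))) / 2)))) 0 (PI / 2))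
      as [s [Hs E]]; [lra| |].
    - intros s _. specialize (Hz s). pose proof (drift_derive b e kap sg s Hkap) as Hd.
      derive_solve. ring.
    - destruct (drift_end b e kap sg Hkap Hres) as [De D0].
      rewrite De, D0, Hz0 in E. fold eta in E.
      specialize (Hz' s ltac:(lra)). apply Rabs_le_between in Hz'.
      set (w := z' s - _) in *. clearbody w.
      assert (w * (PI / 2 - 0) >= - (L ^ 2 * C3) * (PI / 2)) by nra.
      assert (L * (L * C3 * PI) < L * eta) by (apply Rmult_lt_compat_l; assumption).
      nra. }
  assert (HV1 : 0 < x1 (PI / 2) * sin (kap * (PI / 2)) + y1 (PI / 2) * cos (kap * (PI / 2))).
  { apply (Hend (fun s => x1 s * sin (kap * s) + y1 s * cos (kap * s))
      (fun s => (p s - kap) * y1 s * sin (kap * s) + (r s + kap) * x1 s * cos (kap * s)) 1).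
    - rewrite E2, Rmult_0_r, sin_0. ring.
    - intros s. destruct (H1 s). derive_solve. ring.
    - intros s Hs. destruct (Hx1 s Hs). apply Hdrift; try assumption.
      + pose proof (sin2_cos2 (kap * s)). unfold Rsqr in *. lra.
      + rewrite cos_2a_cos. field. }
  assert (HU2 : 0 < - (x2 (PI / 2) * cos (kap * (PI / 2))) + y2 (PI / 2) * sin (kap * (PI / 2))).
  { apply (Hend (fun s => - (x2 s * cos (kap * s)) + y2 s * sin (kap * s))
      (fun s => (p s - kap) * y2 s * - cos (kap * s) + (r s + kap) * x2 s * sin (kap * s)) (-1)).
    - rewrite E3, Rmult_0_r, sin_0. ring.
    - intros s. destruct (H2 s). derive_solve. ring.
    - intros s Hs. destruct (Hx2 s Hs). apply Hdrift; try assumption.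
      + pose proof (sin2_cos2 (kap * s)). unfold Rsqr in *. lra.
      + rewrite cos_2a_sin. field.
      + rewrite Ropp_involutive. assumption. }
  destruct (Hx1 (PI / 2)) as [D1 D2]; [lra|]. destruct (Hx2 (PI / 2)) as [D3 D4]; [lra|].
  assert (SC : sin (kap * (PI / 2)) * cos (kap * (PI / 2)) = 0).
  { replace (kap * PI) with (2 * (kap * (PI / 2))) in Hres by field.
    rewrite sin_2a in Hres. lra. }
  pose proof (sin2_cos2 (kap * (PI / 2))) as S2. unfold Rsqr in S2.
  destruct (Hsc (kap * (PI / 2))) as [bs bc].
  unfold quarter_product.
  set (S := sin (kap * (PI / 2))) in *. set (C := cos (kap * (PI / 2))) in *.
  set (a1 := x1 (PI / 2)) in *. set (c1 := y1 (PI / 2)) in *.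
  set (b1 := x2 (PI / 2)) in *. set (d1 := y2 (PI / 2)) in *.
  (* The other two rotated components are 1 for the pure rotation and off by at most
     [2 L C2 < 1 / 2]. *)
  assert (Hnear : forall g g' f f' k k', Rabs (g - f) <= L * C2 -> Rabs (g' - f') <= L * C2 ->
            Rabs k <= 1 -> Rabs k' <= 1 -> f * k + f' * k' = 1 -> 0 < g * k + g' * k').
  { intros g g' f f' k k' Hg Hg' Hk Hk' Ef.
    assert (A1 : Rabs ((g - f) * k) <= L * C2 * 1)
      by (rewrite Rabs_mult; apply Rmult_le_compat; auto using Rabs_pos).
    assert (A2 : Rabs ((g' - f') * k') <= L * C2 * 1)
      by (rewrite Rabs_mult; apply Rmult_le_compat; auto using Rabs_pos).
    apply Rabs_le_between in A1, A2. lra. }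
  assert (HU1 : 0 < a1 * C + c1 * - S).
  { apply (Hnear _ _ C (- S)); try assumption; [rewrite Rabs_Ropp; exact bs|lra]. }
  assert (HV2 : 0 < b1 * S + d1 * C) by (apply (Hnear _ _ S C); try assumption; lra).
  (* At a resonance [S] or [C] is 0 and the other is 1 or -1, so the rotated entries are the
     original ones up to order and sign. *)
  assert (E : -1 * (a1 * b1 * c1 * d1) =
     (a1 * C + c1 * - S) * (b1 * S + d1 * C) * (a1 * S + c1 * C) * (- (b1 * C) + d1 * S)).
  { destruct (Rmult_integral _ _ SC) as [Z|Z]; rewrite Z in *.
    - replace ((a1 * C + c1 * - 0) * (b1 * 0 + d1 * C) * (a1 * 0 + c1 * C) * (- (b1 * C) + d1 * 0))
        with (-1 * (a1 * b1 * c1 * d1) * (C * C) ^ 2) by ring.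
      replace (C * C) with 1 by lra. ring.
    - replace ((a1 * 0 + c1 * - S) * (b1 * S + d1 * 0) * (a1 * S + c1 * 0) * (- (b1 * 0) + d1 * S))
        with (-1 * (a1 * b1 * c1 * d1) * (S * S) ^ 2) by ring.
      replace (S * S) with 1 by lra. ring. }
  rewrite E. repeat apply Rmult_lt_0_compat; assumption.
Qed.

End SmallAmplitude.

(** * Energy and amplitude *)

Lemma duffing_is_derive m P Th :
  duffing_solution m P Th ->
  forall t, is_derive Th t (Derive Th t) /\
            is_derive (Derive Th) t
              (- (INR m ^ 2 * (INR m ^ 2 - P) * Th t + INR m ^ 4 * Th t ^ 3)).
Proof.
  intros [Hd He] t. destruct (Hd t) as [H1 H2]. split; [apply Derive_correct, H1|].
  replace (- (INR m ^ 2 * (INR m ^ 2 - P) * Th t + INR m ^ 4 * Th t ^ 3))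
    with (Derive (Derive Th) t).
  - apply Derive_correct. exact H2.
  - specialize (He t). change (Derive_n Th 2 t) with (Derive (Derive Th) t) in He. lra.
Qed.

(** [L] is the squared displacement at a turning point: the positive root of the energy with zero
    velocity. *)
Lemma amplitude_exists al be E :
  0 < al -> 0 < be -> 0 < E -> exists L, 0 < L /\ E = al / 2 * L + be / 4 * L ^ 2.
Proof.
  intros Hal Hbe HE. exists ((- al + sqrt (al ^ 2 + 4 * be * E)) / be).
  assert (HbE : 0 < be * E) by (apply Rmult_lt_0_compat; assumption).
  pose proof (sqrt_sqrt (al ^ 2 + 4 * be * E) ltac:(nra)) as Eq.
  pose proof (sqrt_pos (al ^ 2 + 4 * be * E)).
  set (w := sqrt (al ^ 2 + 4 * be * E)) in *. clearbody w.
  split.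
  - apply Rdiv_lt_0_compat; [nra|assumption].
  - replace (al / 2 * ((- al + w) / be) + be / 4 * ((- al + w) / be) ^ 2)
      with ((w * w - al ^ 2) / (4 * be)) by (field; lra).
    rewrite Eq. field. lra.
Qed.

Theorem theorem8 (m n : nat) (P : R)
  (hm : (1 <= m)%nat) (hn : (1 <= n)%nat)
  (hP : 0 <= P) (hPm : P < INR m ^ 2) (hmn : INR m ^ 2 < INR n ^ 2) :
  exists E1 E2 : R, 0 < E1 /\ E1 <= E2 /\
    (forall Theta : R -> R, duffing_solution m P Theta ->
       0 < energy m P Theta < E1 -> linearly_stable m n P Theta) /\
    (I_U (INR n ^ 2 / INR m ^ 2) ->
     forall Theta : R -> R, duffing_solution m P Theta ->
       E2 < energy m P Theta -> linearly_unstable m n P Theta) /\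
    (I_S (INR n ^ 2 / INR m ^ 2) ->
     forall Theta : R -> R, duffing_solution m P Theta ->
       E2 < energy m P Theta -> linearly_stable m n P Theta).
Proof.
  assert (Hm1 : 1 <= INR m) by (apply (le_INR 1), hm).
  set (M2 := INR m ^ 2) in *. set (N2 := INR n ^ 2) in *.
  assert (HM2 : 1 <= M2) by (unfold M2; nra).
  set (al := M2 * (M2 - P)). set (be := INR m ^ 4).
  set (c := N2 * (N2 - P)). set (mu := M2 * N2).
  assert (Hbe2 : be = M2 * M2) by (unfold be, M2; ring).
  assert (Hal : 0 < al) by (apply Rmult_lt_0_compat; lra).
  assert (Hbe : 0 < be) by (rewrite Hbe2; apply Rmult_lt_0_compat; lra).
  assert (Hc : 0 < c) by (apply Rmult_lt_0_compat; lra).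
  assert (Hmu : 0 < mu) by (apply Rmult_lt_0_compat; lra).
  assert (Hgam : mu / be = N2 / M2) by (unfold mu; rewrite Hbe2; field; lra).
  assert (Hkap : 1 < sqrt (c / al)).
  { rewrite <- sqrt_1. apply sqrt_lt_1_alt. split; [lra|].
    apply Rmult_lt_reg_r with al; [assumption|].
    replace (c / al * al) with c by (field; lra). unfold c, al. nra. }
  assert (Heb : mu / c < be / al).
  { replace (mu / c) with (M2 / (N2 - P)) by (unfold mu, c; field; lra).
    replace (be / al) with (M2 / (M2 - P)) by (rewrite Hbe2; unfold al; field; lra).
    apply Rmult_lt_compat_l; [lra|]. apply Rinv_lt_contravar; [nra|lra]. }
  assert (Hsmall : exists L0, 0 < L0 /\ forall L, 0 < L < L0 -> hill_sign (-1) al be c mu (sqrt c) L).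
  { destruct (Req_dec (sin (sqrt (c / al) * PI)) 0) as [Z|Z].
    - apply hill_sign_small_resonant; assumption.
    - apply hill_sign_small_nonresonant; assumption. }
  assert (Hlarge : exists L0, 0 < L0 /\ forall L, L0 < L ->
            (I_U (N2 / M2) -> hill_sign 1 al be c mu (sqrt (be * L)) L) /\
            (I_S (N2 / M2) -> hill_sign (-1) al be c mu (sqrt (be * L)) L)).
  { assert (HU : exists L0, I_U (N2 / M2) ->
              forall L, L0 < L -> 0 < L -> hill_sign 1 al be c mu (sqrt (be * L)) L).
    { destruct (classic (I_U (N2 / M2))) as [HI|HI]; [|exists 0; contradiction].
      destruct (hill_sign_large 1 al be c mu Hal Hbe Hc Hmu) as [L0 H0].
      - rewrite Hgam. apply lame_sign_U, HI.
      - exists L0. intros _. exact H0. }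
    assert (HS : exists L0, I_S (N2 / M2) ->
              forall L, L0 < L -> 0 < L -> hill_sign (-1) al be c mu (sqrt (be * L)) L).
    { destruct (classic (I_S (N2 / M2))) as [HI|HI]; [|exists 0; contradiction].
      destruct (hill_sign_large (-1) al be c mu Hal Hbe Hc Hmu) as [L0 H0].
      - rewrite Hgam. apply lame_sign_S, HI.
      - exists L0. intros _. exact H0. }
    destruct HU as [LU HU]. destruct HS as [LS HS].
    exists (1 + Rabs LU + Rabs LS).
    pose proof (Rabs_pos LU). pose proof (Rabs_pos LS).
    pose proof (Rle_abs LU). pose proof (Rle_abs LS).
    split; [lra|]. intros L HL. split; intros HI; [apply HU|apply HS]; try assumption; lra. }
  destruct Hsmall as (La & HLa & Hsmall). destruct Hlarge as (Lb & HLb & Hlarge).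
  assert (Hred : forall Th, duffing_solution m P Th -> 0 < energy m P Th ->
     exists L, 0 < L /\ energy m P Th = al / 2 * L + be / 4 * L ^ 2 /\
       forall lam, 0 < lam ->
       (hill_sign (-1) al be c mu lam L -> linearly_stable m n P Th) /\
       (hill_sign 1 al be c mu lam L -> linearly_unstable m n P Th)).
  { intros Th HT HE. destruct (amplitude_exists al be _ Hal Hbe HE) as (L & HL & EL).
    exists L. split; [assumption|]. split; [assumption|]. intros lam Hlam.
    destruct (duffing_phase al be L Th (Derive Th)) as (S & HS & HSin); try assumption.
    - intros t. apply (duffing_is_derive m P Th HT t).
    - intros t. apply (duffing_is_derive m P Th HT t).
    - apply (hill_sign_alternative al be c mu lam L S); try assumption.
      intros t. unfold hill_coef. rewrite HSin. reflexivity. }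
  assert (Hinc : forall L L', 0 < L -> 0 < L' -> L <= L' ->
            al / 2 * L + be / 4 * L ^ 2 <= al / 2 * L' + be / 4 * L' ^ 2).
  { intros L L' H0 H0' Hle. assert (L ^ 2 <= L' ^ 2) by (apply pow_incr; lra). nra. }
  (* The energy is at least [al / 2 * L], so energy below [E1] forces [L < La]. In [E2] the maximum
     with [E1] secures [E1 <= E2]. *)
  set (E1 := al / 2 * La). set (E2 := Rmax E1 (al / 2 * Lb + be / 4 * Lb ^ 2)).
  assert (HE1 : 0 < E1) by (apply Rmult_lt_0_compat; lra).
  assert (HE2 : forall Th, E2 < energy m P Th -> 0 < energy m P Th /\
            al / 2 * Lb + be / 4 * Lb ^ 2 < energy m P Th).
  { intros Th H. pose proof (Rmax_l E1 (al / 2 * Lb + be / 4 * Lb ^ 2)).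
    pose proof (Rmax_r E1 (al / 2 * Lb + be / 4 * Lb ^ 2)). unfold E2 in H. lra. }
  exists E1, E2. split; [assumption|]. split; [apply Rmax_l|]. split; [|split].
  - intros Th HT [HE0 HE]. destruct (Hred Th HT HE0) as (L & HL & EL & Hres).
    apply (Hres (sqrt c)); [apply sqrt_lt_R0, Hc|]. apply Hsmall. split; [assumption|].
    assert (0 <= be / 4 * L ^ 2) by (apply Rmult_le_pos; [lra|apply pow2_ge_0]).
    unfold E1 in HE. nra.
  - intros HI Th HT HE. destruct (HE2 Th HE) as [HE0 HEb].
    destruct (Hred Th HT HE0) as (L & HL & EL & Hres).
    apply (Hres (sqrt (be * L))); [apply sqrt_lt_R0, Rmult_lt_0_compat; assumption|].
    apply Hlarge; [|assumption].
    destruct (Rlt_dec Lb L) as [|Hn]; [assumption|]. specialize (Hinc L Lb HL HLb ltac:(lra)). lra.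
  - intros HI Th HT HE. destruct (HE2 Th HE) as [HE0 HEb].
    destruct (Hred Th HT HE0) as (L & HL & EL & Hres).
    apply (Hres (sqrt (be * L))); [apply sqrt_lt_R0, Rmult_lt_0_compat; assumption|].
    apply Hlarge; [|assumption].
    destruct (Rlt_dec Lb L) as [|Hn]; [assumption|]. specialize (Hinc L Lb HL HLb ltac:(lra)). lra.
Qed.
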